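(* Let $n\in\mathbb{N}$ and let $\Gamma$ be a residually finite infinite amenable group of type $\mathsf{FP}_n$. Then $\Gamma\in\mathsf{CWR}_n$.
   Context: $\mathbb{N}=\{0,1,2,\dots\}$. A residual chain $\Lambda_*=(\Lambda_i)_{i\in\mathbb{N}}$ in a group $\Gamma$ is a nested sequence $\Gamma=\Lambda_0\ge\Lambda_1\ge\cdots$ of finite index normal subgroups of $\Gamma$ with $\bigcap_i\Lambda_i=\{1\}$; $\Gamma$ is residually finite if it admits a residual chain. $\Gamma$ is of type $\mathsf{FP}_n$ if the trivial $\mathbb{Z}\Gamma$-module $\mathbb{Z}$ has a projective resolution $P$ with $P_j$ finitely generated for all $j\le n$. A based free module is a free module with a chosen basis. A based free $\mathbb{Z}$-module carries the $\ell^1$-norm of its basis; $\|f\|$ denotes the operator norm of a map between based free $\mathbb{Z}$-modules. A chain complex is based free if all its chain modules are. A homotopy retract $(X,X',\xi,\xi',\Xi)$ consists of chain complexes $X,X'$, chain maps $\xi\colon X\to X'$, $\xi'\colon X'\to X$, and a chain homotopy $\Xi_j\colon X_j\to X_{j+1}$ with $\partial\Xi+\Xi\partial=\mathrm{id}_X-\xi'\xi$. Let $X,X'$ be based free $\mathbb{Z}$-chain complexes with $X_j,X'_j$ finitely generated for $j\le n$, and $T,\kappa\in\mathbb{R}_{\ge1}$. The homotopy retract is a weak $n$-rebuilding of $X$ of quality $(T,\kappa)$ if for all $j\le n$: $\mathrm{rk}_{\mathbb{Z}}(X'_j)\le\kappa T^{-1}\mathrm{rk}_{\mathbb{Z}}(X_j)$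 and $\|\partial^{X'}_j\|,\|\xi_j\|\le\exp(\kappa)T^\kappa$. For a $\mathbb{Z}\Gamma$-chain complex $X$ and $\Lambda\le\Gamma$, $X_\Lambda:=\mathbb{Z}\otimes_{\mathbb{Z}\Lambda}X$; if $X$ is based free over $\mathbb{Z}\Gamma$, then $X_\Lambda$ is based free over $\mathbb{Z}$ with the induced basis (the images of $\gamma e$, $\gamma\in\Gamma$, $e$ a basis element). $\mathsf{CWR}^\Gamma_n$ is the class of based free $\mathbb{Z}\Gamma$-chain complexes $X$ with $X_j$ finitely generated over $\mathbb{Z}\Gamma$ for all $j\le n$ such that: there exists $\kappa\ge1$ such that for all $T\ge1$ and all residual chains $\Lambda_*$ in $\Gamma$ there is $i_0\in\mathbb{N}$ such that for all $i\ge i_0$ the complex $X_{\Lambda_i}$ admits a weak $n$-rebuilding of quality $(T,\kappa)$. $\mathsf{CWR}_n$ is the class of residually finite groups $\Gamma$ for which the trivial module $\mathbb{Z}$ admits a projective $\mathbb{Z}\Gamma$-resolution lying in $\mathsf{CWR}^\Gamma_n$. *)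

(* Defs.v *)
From HB Require Import structures.
From mathcomp Require Import all_boot all_order all_algebra.
From mathcomp Require Import finmap monalg.
From mathcomp Require Import all_classical all_reals all_analysis.

Set Implicit Arguments.
Unset Strict Implicit.
Unset Printing Implicit Defensive.

Import Order.TTheory GRing.Theory Num.Theory.
Local Open Scope classical_set_scope.
Local Open Scope quotient_scope.
Local Open Scope ring_scope.

Section Groups.
Context (G : groupType).
Local Open Scope group_scope.

Definition subgroup (H : set G) : Prop :=
  H 1 /\ forall x y, H x -> H y -> H (x / y).

Definition normal_subgroup (H : set G) : Prop :=
  subgroup H /\ forall x g, H x -> H (x ^ g).

Definition finite_index (H : set G) : Prop :=
  finite_set (range (fun g : G => [set g * h | h in H])).

Definition residual_chain (L : nat -> set G) : Prop :=
  [/\ L 0%N = setT,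
      forall i, L i.+1 `<=` L i,
      forall i, normal_subgroup (L i) /\ finite_index (L i) &
      \bigcap_i L i = [set 1]].

Definition residually_finite : Prop :=
  exists L : nat -> set G, residual_chain L.

End Groups.

(* The Folner condition: |sF \triangle F| <= e |F| for all s in S. *)
Definition amenable (R : realType) (G : groupType) : Prop :=
  forall (S : {fset G}) (e : R), 0 < e ->
  exists F : {fset G}, F != fset0 /\
    forall s, s \in S ->
      let sF := [fset (s * x)%g | x in F]%fset in
      (#|` ((sF `\` F) `|` (F `\` sF))%fset |)%:R <= e * (#|` F |)%:R.

(* The ring structure that monalg puts on {malg int[K]} requires a monoid in
   which only 1 is invertible, so the convolution product is defined here. *)
Definition group_ring (G : groupType) : Type := {malg int[G]}.

Section GroupRing.
Context (G : groupType).
Local Notation ZG := (group_ring G).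
Implicit Types r s : {malg int[G]}.

HB.instance Definition _ := GRing.Zmodule.on ZG.

Definition gr_one : ZG := << (1 : G)%g >>.

Definition gr_mul (r s : ZG) : ZG :=
  \sum_(g <- msupp r) \sum_(h <- msupp s) << r@_g * s@_h *g (g * h)%g >>.

Lemma gr_mulw (d1 d2 : {fset G}) r s :
  (msupp r `<=` d1)%fset -> (msupp s `<=` d2)%fset ->
  gr_mul r s = \sum_(g <- d1) \sum_(h <- d2) << r@_g * s@_h *g (g * h)%g >>.
Proof.
move=> le1 le2; rewrite /gr_mul (big_fset_incl _ le1) /=.
  apply: eq_bigr => g _; apply: big_fset_incl => // h _ /mcoeff_outdom ->.
  by rewrite mulr0 monalgU0.
move=> g _ /mcoeff_outdom rg.
by rewrite big1 // => h _; rewrite rg mul0r monalgU0.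
Qed.

Lemma gr_mulDl : left_distributive gr_mul +%R.
Proof.
move=> r1 r2 s.
rewrite (gr_mulw (msuppD_le r1 r2) (fsubset_refl _)).
rewrite (gr_mulw (fsubsetUl _ (msupp r2)) (fsubset_refl _)).
rewrite (gr_mulw (fsubsetUr (msupp r1) _) (fsubset_refl _)).
rewrite -big_split /=; apply: eq_bigr => g _.
rewrite -big_split /=; apply: eq_bigr => h _.
by rewrite mcoeffD mulrDl monalgUD.
Qed.

Lemma gr_mulDr : right_distributive gr_mul +%R.
Proof.
move=> s r1 r2.
rewrite (gr_mulw (fsubset_refl _) (msuppD_le r1 r2)).
rewrite (gr_mulw (fsubset_refl _) (fsubsetUl _ (msupp r2))).
rewrite (gr_mulw (fsubset_refl _) (fsubsetUr (msupp r1) _)).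
rewrite -big_split /=; apply: eq_bigr => g _.
rewrite -big_split /=; apply: eq_bigr => h _.
by rewrite mcoeffD mulrDr monalgUD.
Qed.

Lemma gr_mul0r : left_zero 0 gr_mul.
Proof. by move=> r; rewrite /gr_mul msupp0 big_seq_fset0. Qed.

Lemma gr_mulr0 : right_zero 0 gr_mul.
Proof.
by move=> r; rewrite /gr_mul big1 // => g _; rewrite msupp0 big_seq_fset0.
Qed.

Lemma gr_mulUU (a b : int) (g h : G) :
  gr_mul << a *g g >> << b *g h >> = << a * b *g (g * h)%g >>.
Proof.
have le x k : (msupp (<< x *g k >> : {malg int[G]}) `<=` [fset k])%fset.
  exact: msuppU_le.
by rewrite (gr_mulw (le _ _) (le _ _)) !big_seq_fset1 !mcoeffUU.
Qed.

Lemma gr_mul_suml I (u : seq I) (F : I -> ZG) (s : ZG) :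
  gr_mul (\sum_(i <- u) F i) s = \sum_(i <- u) gr_mul (F i) s.
Proof.
exact: (big_morph (gr_mul^~ s) (fun _ _ => gr_mulDl _ _ _) (gr_mul0r _)).
Qed.

Lemma gr_mul_sumr I (u : seq I) (F : I -> ZG) (s : ZG) :
  gr_mul s (\sum_(i <- u) F i) = \sum_(i <- u) gr_mul s (F i).
Proof.
exact: (big_morph (gr_mul s) (fun _ _ => gr_mulDr _ _ _) (gr_mulr0 _)).
Qed.

Lemma gr_mulEl (r s : ZG) :
  gr_mul r s = \sum_(g <- msupp r) gr_mul << r@_g *g g >> s.
Proof. by rewrite [in LHS](monalgE r); exact: gr_mul_suml. Qed.

Lemma gr_mulEr (r s : ZG) :
  gr_mul r s = \sum_(g <- msupp s) gr_mul r << s@_g *g g >>.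
Proof. by rewrite [in LHS](monalgE s); exact: gr_mul_sumr. Qed.

Lemma gr_mulA : associative gr_mul.
Proof.
move=> r s t; rewrite [LHS]gr_mulEl [in RHS](gr_mulEl r s) [RHS]gr_mul_suml.
apply: eq_bigr => g _; rewrite (gr_mulEl s t) (gr_mulEr _ s).
rewrite [LHS]gr_mul_sumr [RHS]gr_mul_suml; apply: eq_bigr => h _.
rewrite (gr_mulEr _ t) [LHS]gr_mul_sumr [RHS]gr_mulEr; apply: eq_bigr => k _.
by rewrite !gr_mulUU mulrA mulgA.
Qed.

Lemma gr_mul1r : left_id gr_one gr_mul.
Proof.
move=> r; rewrite [LHS]gr_mulEr [RHS]monalgE.
by apply: eq_bigr => g _; rewrite gr_mulUU mul1r mul1g.
Qed.

Lemma gr_mulr1 : right_id gr_one gr_mul.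
Proof.
move=> r; rewrite [LHS]gr_mulEl [RHS]monalgE.
by apply: eq_bigr => g _; rewrite gr_mulUU mulr1 mulg1.
Qed.

Lemma gr_one_neq0 : gr_one != 0.
Proof. by rewrite /gr_one monalgU_eq0 oner_eq0. Qed.

HB.instance Definition _ := GRing.Zmodule_isNzRing.Build ZG
  gr_mulA gr_mul1r gr_mulr1 gr_mulDl gr_mulDr gr_one_neq0.

Definition augmentation (r : ZG) : int := \sum_(g <- msupp r) r@_g.

Lemma augmentationw (d : {fset G}) r :
  (msupp r `<=` d)%fset -> augmentation r = \sum_(g <- d) r@_g.
Proof.
move=> le; rewrite /augmentation (big_fset_incl _ le) // => g _.
exact: mcoeff_outdom.
Qed.

Lemma augmentationD r s :
  augmentation (r + s) = augmentation r + augmentation s.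
Proof.
rewrite (augmentationw (msuppD_le r s)).
rewrite (augmentationw (fsubsetUl _ (msupp s))).
rewrite (augmentationw (fsubsetUr (msupp r) _)).
by rewrite -big_split; apply: eq_bigr => g _; rewrite mcoeffD.
Qed.

Lemma augmentation0 : augmentation 0 = 0.
Proof. by rewrite /augmentation msupp0 big_seq_fset0. Qed.

Lemma augmentation_sum I (t : seq I) (F : I -> ZG) :
  augmentation (\sum_(i <- t) F i) = \sum_(i <- t) augmentation (F i).
Proof. exact: (big_morph augmentation augmentationD augmentation0). Qed.

Lemma augmentationU (a : int) (g : G) : augmentation << a *g g >> = a.
Proof.
have le : (msupp (<< a *g g >> : {malg int[G]}) `<=` [fset g])%fset.
  exact: msuppU_le.
by rewrite (augmentationw le) big_seq_fset1 mcoeffUU.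
Qed.

Lemma augmentationM (r s : ZG) :
  augmentation (r * s) = augmentation r * augmentation s.
Proof.
rewrite [LHS]augmentation_sum [X in X * _]/augmentation big_distrl /=.
apply: eq_bigr => g _; rewrite augmentation_sum big_distrr /=.
by apply: eq_bigr => h _; rewrite augmentationU.
Qed.

Lemma augmentation1 : augmentation 1 = 1.
Proof. exact: augmentationU. Qed.

End GroupRing.

Definition trivial_module (G : groupType) : Type := int.

Section TrivialModule.
Context (G : groupType).

HB.instance Definition _ := GRing.Zmodule.on (trivial_module G).

(* Group elements act trivially, hence r acts by its augmentation. *)
Definition triv_scale (r : group_ring G) (a : trivial_module G) :
  trivial_module G := (augmentation r * (a : int) : int).

Fact triv_scaleA r s a : triv_scale r (triv_scale s a) = triv_scale (r * s) a.
Proof. by rewrite /triv_scale augmentationM mulrA. Qed.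

Fact triv_scale1r : left_id 1 triv_scale.
Proof. by move=> a; rewrite /triv_scale augmentation1 mul1r. Qed.

Fact triv_scaleDr : right_distributive triv_scale +%R.
Proof. by move=> r a b; exact: mulrDr. Qed.

Fact triv_scaleDl a : {morph triv_scale^~ a : r s / r + s}.
Proof. by move=> r s; rewrite /triv_scale augmentationD mulrDl. Qed.

HB.instance Definition _ :=
  GRing.Zmodule_isLmodule.Build (group_ring G) (trivial_module G)
    triv_scaleA triv_scale1r triv_scaleDr triv_scaleDl.

End TrivialModule.

Section Modules.
Context (R : nzRingType) (M : lmodType R).

Definition lincomb (c : {malg R[M]}) : M := \sum_(b <- msupp c) c@_b *: b.

Definition expands (B : set M) (x : M) (c : {malg R[M]}) : Prop :=
  [set` msupp c] `<=` B /\ lincomb c = x.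

Definition is_basis (B : set M) : Prop :=
  forall x, exists! c, expands B x c.

(* The coordinates of [x] in the basis [B] (0 when there is no expansion). *)
Definition coordinates (B : set M) (x : M) : {malg R[M]} :=
  xget 0 [set c | expands B x c].

Definition finitely_generated : Prop :=
  exists B : {fset M}, forall x, exists c, expands [set` B] x c.

Definition projective : Prop :=
  forall (N Q : lmodType R) (p : {linear N -> Q}) (f : {linear M -> Q}),
    (forall y, exists x, p x = y) ->
    exists g : {linear M -> N}, forall x, p (g x) = f x.

End Modules.

(* Complexes are concentrated in degrees j >= 0; [bd X j] is the differential
   X_(j+1) -> X_j, the one leaving X_0 being zero. *)
Record chain_complex (R : nzRingType) := ChainComplex {
  chain_module :> nat -> lmodType R;
  bd : forall j, {linear chain_module j.+1 -> chain_module j};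
  bd_bd : forall j x, bd j (bd j.+1 x) = 0 }.

Definition based_free (R : nzRingType) (X : chain_complex R)
    (B : forall j, set (X j)) : Prop :=
  forall j, is_basis (B j).

Record homotopy_retract (R : nzRingType) (X X' : chain_complex R) :=
  HomotopyRetract {
  hr_to : forall j, {linear X j -> X' j};
  hr_from : forall j, {linear X' j -> X j};
  hr_htpy : forall j, {linear X j -> X j.+1};
  hr_toP : forall j x, bd X' j (hr_to j.+1 x) = hr_to j (bd X j x);
  hr_fromP : forall j x, bd X j (hr_from j.+1 x) = hr_from j (bd X' j x);
  hr_htpy0 : forall x, bd X 0 (hr_htpy 0 x) = x - hr_from 0 (hr_to 0 x);
  hr_htpyS : forall j x,
    bd X j.+1 (hr_htpy j.+1 x) + hr_htpy j (bd X j x) =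
    x - hr_from j.+1 (hr_to j.+1 x) }.

Definition projective_resolution (G : groupType)
    (P : chain_complex (group_ring G))
    (eta : {linear P 0%N -> trivial_module G}) : Prop :=
  [/\ forall j, projective (P j),
      forall a, exists x, eta x = a,
      forall x, eta x = 0 <-> exists y, bd P 0 y = x &
      forall j x, bd P j x = 0 <-> exists y, bd P j.+1 y = x].

Definition FP (n : nat) (G : groupType) : Prop :=
  exists (P : chain_complex (group_ring G))
         (eta : {linear P 0%N -> trivial_module G}),
    projective_resolution eta /\
    forall j, (j <= n)%N -> finitely_generated (P j).

Section QuotientBySpan.
Context (V : zmodType).

Definition add_subgroup (H : set V) : Prop :=
  H 0 /\ forall x y, H x -> H y -> H (x - y).

Definition add_span (S : set V) : set V := smallest add_subgroup S.

Definition add_span_pred (S : set V) : pred V := [pred x | `[< add_span S x >]].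

Fact add_span_closed S : zmod_closed (add_span_pred S).
Proof.
have inP x : reflect (add_span S x) (x \in add_span_pred S) by exact: asboolP.
split=> [|x y /inP Sx /inP Sy]; first by apply/inP => H [[]].
by apply/inP => H HS; case: (HS) => -[_ HB] _; apply: HB; [apply: Sx|apply: Sy].
Qed.

HB.instance Definition _ S :=
  GRing.isZmodClosed.Build V (add_span_pred S) (add_span_closed S).

Definition quot_by (S : set V) : zmodType :=
  Quotient.quot (GRing.ZmodClosed.clone V (add_span_pred S) _).

Definition quot_proj (S : set V) (x : V) : quot_by S :=
  \pi_(Quotient.quot (GRing.ZmodClosed.clone V (add_span_pred S) _)) x.

Definition quot_repr (S : set V) (q : quot_by S) : V :=
  repr (q : Quotient.quot (GRing.ZmodClosed.clone V (add_span_pred S) _)).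

Lemma quot_reprK S : cancel (@quot_repr S) (@quot_proj S).
Proof. by move=> q; rewrite /quot_proj /quot_repr reprK. Qed.

Fact quot_proj_is_zmod_morphism S : zmod_morphism (@quot_proj S).
Proof. by move=> x y; rewrite /quot_proj raddfB. Qed.

HB.instance Definition _ S :=
  GRing.isZmodMorphism.Build V (quot_by S) (@quot_proj S)
    (quot_proj_is_zmod_morphism S).

Lemma quot_projP S x y : quot_proj S x = quot_proj S y <-> add_span S (x - y).
Proof.
have e : (x - y \in add_span_pred S) = (quot_proj S x == quot_proj S y).
  exact: Quotient.idealrBE.
split=> [/eqP|xy]; first by rewrite -e => /asboolP.
by apply/eqP; rewrite -e; apply/asboolP.
Qed.

End QuotientBySpan.

Section FreeAbelian.
Context (K : choiceType) (V : zmodType) (h : K -> V).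

Definition free_lift (z : {malg int[K]}) : V := \sum_(k <- msupp z) h k *~ z@_k.

Lemma free_liftw (d : {fset K}) (z : {malg int[K]}) :
  (msupp z `<=` d)%fset -> free_lift z = \sum_(k <- d) h k *~ z@_k.
Proof.
move=> le; rewrite /free_lift (big_fset_incl _ le) // => k _ /mcoeff_outdom ->.
by rewrite mulr0z.
Qed.

Lemma free_liftB : {morph free_lift : x y / x - y}.
Proof.
move=> x y; rewrite (free_liftw (msuppB_le x y)).
rewrite (free_liftw (fsubsetUl _ (msupp y))).
rewrite (free_liftw (fsubsetUr (msupp x) _)).
by rewrite -sumrB; apply: eq_bigr => k _; rewrite mcoeffB mulrzBr.
Qed.

Lemma free_liftU k : free_lift << k >> = h k.
Proof.
have le : (msupp (<< k >> : {malg int[K]}) `<=` [fset k])%fset.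
  exact: msuppU_le.
by rewrite (free_liftw le) big_seq_fset1 mcoeffUU.
Qed.

End FreeAbelian.

Section Tensor.
Context (G : groupType) (L : set G) (M : lmodType (group_ring G)).
Local Notation free := {malg int[(int * M)%type]}.

(* Z (x)_{ZL} M is the quotient of the free abelian group on Z x M by
   biadditivity and by (a.r) (x) x = a (x) (r x) for r in ZL. Here ZL is the
   subring of the elements of ZG supported in [L], and it acts on Z on the
   right through the augmentation. *)
Definition supported_in (r : group_ring G) : Prop := [set` msupp r] `<=` L.

Definition tensor_relations : set free :=
  [set z | (exists (a b : int) (x : M),
              z = << (a + b, x) >> - (<< (a, x) >> + << (b, x) >>))
        \/ (exists (a : int) (x y : M),
              z = << (a, x + y) >> - (<< (a, x) >> + << (a, y) >>))
        \/ (exists (a : int) (r : group_ring G) (x : M),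
              supported_in r /\
              z = << (a * augmentation r, x) >> - << (a, r *: x) >>)].

Definition tensor : zmodType := quot_by tensor_relations.

Definition tens (a : int) (x : M) : tensor := quot_proj tensor_relations << (a, x) >>.

Definition tensor_lift (V : zmodType) (h : int -> M -> V) (t : tensor) : V :=
  free_lift (fun k => h k.1 k.2) (quot_repr t).

Definition balanced (V : zmodType) (h : int -> M -> V) : Prop :=
  [/\ forall a b x, h (a + b) x = h a x + h b x,
      forall a x y, h a (x + y) = h a x + h a y &
      forall a r x, supported_in r -> h (a * augmentation r) x = h a (r *: x)].

Lemma tens_balanced : balanced tens.
Proof.
split=> [a b x|a x y|a r x Lr]; rewrite /tens.
- rewrite -[RHS]raddfD; apply/quot_projP => H [_]; apply; left.
  by exists a, b, x.
- rewrite -[RHS]raddfD; apply/quot_projP => H [_]; apply; right; left.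
  by exists a, x, y.
- by apply/quot_projP => H [_]; apply; right; right; exists a, r, x.
Qed.

Section Lift.
Context (V : zmodType) (h : int -> M -> V) (hb : balanced h).

Lemma tensor_lift_pi (z : free) :
  tensor_lift h (quot_proj tensor_relations z) =
  free_lift (fun k => h k.1 k.2) z.
Proof.
apply/eqP; rewrite -subr_eq0 -free_liftB; apply/eqP.
set f := free_lift _; set p := quot_proj _.
have /quot_projP : p (quot_repr (p z)) = p z by rewrite /p quot_reprK.
move=> /(_ [set y | f y = 0]); apply => {p z}.
have fB : {morph f : x y / x - y}.
  exact: free_liftB.
have f0 : f 0 = 0 by have := fB 0 0; rewrite !subrr.
have fD : {morph f : x y / x + y}.
  by move=> x y; rewrite -[y in LHS]opprK fB -[- y]add0r fB f0 sub0r opprK.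
have fU k : f << k >> = h k.1 k.2 by exact: free_liftU.
have [hDl hDr hL] := hb.
split=> [|z]; first by split=> // x y /= fx fy; rewrite fB fx fy subrr.
case=> [[a [b [x ->]]]|[[a [x [y ->]]]|[a [r [x [Lr ->]]]]]] /=.
- by rewrite fB fD !fU /= hDl subrr.
- by rewrite fB fD !fU /= hDr subrr.
- by rewrite fB !fU /= hL // subrr.
Qed.

Lemma tensor_lift_tens a x : tensor_lift h (tens a x) = h a x.
Proof. by rewrite tensor_lift_pi free_liftU. Qed.

Lemma tensor_liftB : {morph tensor_lift h : s t / s - t}.
Proof.
move=> s t; rewrite -[s]quot_reprK -[t]quot_reprK -raddfB !tensor_lift_pi.
exact: free_liftB.
Qed.

End Lift.

Lemma tensor_ind (P : tensor -> Prop) :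
  P 0 -> (forall s t, P s -> P t -> P (s - t)) ->
  (forall a x, P (tens a x)) -> forall t, P t.
Proof.
move=> P0 PB Pt t; rewrite -[t]quot_reprK; move: (quot_repr t) => {t} z.
have PN s : P s -> P (- s) by move=> Ps; rewrite -sub0r; apply: PB.
have PD s t : P s -> P t -> P (s + t).
  by move=> Ps /PN Pt'; rewrite -[t]opprK; apply: PB.
have Pn s (n : nat) : P s -> P (s *+ n).
  by move=> Ps; elim: n => [|n IHn]; rewrite ?mulr0n // mulrS; apply: PD.
have UE (c : int) k : << c *g k >> = << k >> *~ c :> free.
  by rewrite -(raddfMz (mkmalgU k)) intz.
rewrite (monalgE z) raddf_sum; apply: big_ind => //= -[a x] _.
rewrite UE raddfMz -/(tens a x); case: (z@_(a, x)) => n.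
  exact: (Pn _ n (Pt a x)).
by rewrite NegzE mulrNz; apply: PN; exact: (Pn _ n.+1 (Pt a x)).
Qed.

End Tensor.

Section TensorMap.
Context (G : groupType) (L : set G) (M N : lmodType (group_ring G)).
Context (f : {linear M -> N}).

(* The induced map id (x) f; [zmodule] turns an abelian group into a module
   over [int]. *)
Definition tensor_map (t : zmodule (tensor L M)) : zmodule (tensor L N) :=
  tensor_lift (fun a x => tens L a (f x)) t.

Lemma tensor_map_balanced :
  balanced L (fun a (x : M) => tens L a (f x) : tensor L N).
Proof.
have [tDl tDr tL] := tens_balanced L N.
split=> [a b x|a x y|a r x Lr]; first exact: tDl.
  by rewrite linearD tDr.
by rewrite linearZ tL.
Qed.

Lemma tensor_map_tens a x : tensor_map (tens L a x) = tens L a (f x).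
Proof. exact: (tensor_lift_tens tensor_map_balanced). Qed.

Fact tensor_map_is_zmod_morphism : zmod_morphism tensor_map.
Proof. exact: (tensor_liftB tensor_map_balanced). Qed.

HB.instance Definition _ :=
  GRing.isZmodMorphism.Build _ _ tensor_map tensor_map_is_zmod_morphism.

Fact tensor_map_is_scalable : scalable tensor_map.
Proof. by move=> n t; exact: raddfMz. Qed.

HB.instance Definition _ :=
  GRing.isScalable.Build _ _ _ _ tensor_map tensor_map_is_scalable.

End TensorMap.
Arguments tensor_map {G} L {M N} f t.

Section Induced.
Context (G : groupType) (X : chain_complex (group_ring G)) (L : set G).

Fact induced_bd_bd j (t : zmodule (tensor L (X j.+2))) :
  tensor_map L (bd X j) (tensor_map L (bd X j.+1) t) = 0.
Proof.
elim/tensor_ind: t => [|s t hs ht|a x].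
- by rewrite !raddf0.
- rewrite !raddfB; exact: etrans (congr2 (fun u v => u - v) hs ht) (subrr 0).
- rewrite !tensor_map_tens bd_bd.
  have [_ tDr _] := tens_balanced L (X j).
  have := tDr a 0 0; rewrite addr0 => /esym/eqP.
  by rewrite -subr_eq0 addrK => /eqP.
Qed.

(* The complex X_L = Z (x)_{ZL} X. *)
Definition induced_complex : chain_complex int :=
  @ChainComplex int (fun j => zmodule (tensor L (X j)))
    (fun j => tensor_map L (bd X j)) induced_bd_bd.

Definition induced_basis (B : forall j, set (X j)) (j : nat) :
    set (induced_complex j) :=
  [set t | exists (g : G) (e : X j),
     B j e /\ t = tens L 1 ((<< g >> : group_ring G) *: e)].

End Induced.
Arguments induced_basis {G X} L B j.

Section Norms.
Context (R : realType).

Definition l1_norm (M : lmodType int) (B : set M) (x : M) : nat :=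
  \sum_(b <- msupp (coordinates B x)) `|(coordinates B x)@_b|%N.

(* For x = 0 the quotient is 0 / 0 = 0, so that the norm of a map out of the
   zero module is 0. *)
Definition operator_norm (M N : lmodType int) (B : set M) (C : set N)
    (f : M -> N) : \bar R :=
  ereal_sup (range (fun x : M =>
    ((l1_norm C (f x))%:R / (l1_norm B x)%:R : R)%:E)).

(* Meaningful for a finite basis only ([fset_set] of an infinite set is empty);
   a basis of a finitely generated module is finite. *)
Definition rank (M : lmodType int) (B : set M) : nat := #|` fset_set B |.

(* The bound on the differential leaving X'_0 holds trivially. *)
Definition weak_rebuilding (n : nat) (T kappa : R)
    (X X' : chain_complex int)
    (B : forall j, set (X j)) (B' : forall j, set (X' j))
    (h : homotopy_retract X X') : Prop :=
  [/\ based_free B /\ based_free B',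
      forall j, (j <= n)%N ->
        finitely_generated (X j) /\ finitely_generated (X' j),
      forall j, (j <= n)%N ->
        (rank (B' j))%:R <= kappa * T^-1 * (rank (B j))%:R,
      forall j, (j.+1 <= n)%N ->
        (operator_norm (B' j.+1) (B' j) (bd X' j)
           <= (expR kappa * T `^ kappa)%:E)%E &
      forall j, (j <= n)%N ->
        (operator_norm (B j) (B' j) (hr_to h j)
           <= (expR kappa * T `^ kappa)%:E)%E].

Definition admits_weak_rebuilding (n : nat) (T kappa : R)
    (X : chain_complex int) (B : forall j, set (X j)) : Prop :=
  exists (X' : chain_complex int) (B' : forall j, set (X' j))
         (h : homotopy_retract X X'),
    weak_rebuilding n T kappa B B' h.

Definition CWR_complex (n : nat) (G : groupType)
    (X : chain_complex (group_ring G)) (B : forall j, set (X j)) : Prop :=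
  [/\ based_free B,
      forall j, (j <= n)%N -> finitely_generated (X j) &
      exists kappa : R, 1 <= kappa /\
        forall T : R, 1 <= T ->
        forall L : nat -> set G, residual_chain L ->
        exists i0 : nat, forall i, (i0 <= i)%N ->
          admits_weak_rebuilding n T kappa (induced_basis (L i) B)].

Definition CWR (n : nat) (G : groupType) : Prop :=
  residually_finite G /\
  exists (X : chain_complex (group_ring G))
         (eta : {linear X 0%N -> trivial_module G})
         (B : forall j, set (X j)),
    projective_resolution eta /\ CWR_complex n B.

End Norms.

(* Main.v *)
(* A free resolution X of Z is made from a projective one by adding elementary
   complexes C -id-> C. For L deep in a residual chain there is a Folner
   transversal D of L\G (Weiss). Let Y be the subcomplex of the quotient X_L
   spanned by the cells x.b, j <= n, with x well inside D. It lifts to X, which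
   has a Z-linear contraction s onto Z, so that the inclusion of Y into X_L is
   homotopic to the augmentation followed by the choice of a base point.
   Extending this homotopy by 0 to the other cells makes X_L a homotopy retract
   of X_L / Y with one generator added in degree 0 to record the augmentation.
   The rank of the latter is the number of cells near the boundary of D, plus
   one, while its differential and the projection onto it are bounded in terms
   of X alone; no control of s is needed. *)
Require Import Defs.
From HB Require Import structures.
From mathcomp Require Import all_boot all_order all_algebra all_fingroup.
From mathcomp Require Import finmap monalg zify ring.
From mathcomp Require Import all_classical all_reals all_analysis.

Set Implicit Arguments.
Unset Strict Implicit.
Unset Printing Implicit Defensive.

Import Order.TTheory GRing.Theory Num.Theory.
Local Open Scope classical_set_scope.
Local Open Scope ring_scope.

(** * Folner transversals *)

(** The contraction [s] is additive but not equivariant, so it does not descend to [X_L]. It is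
    transported by lifting each coset to its representative in [D], and this lift is compatible with
    the differential on cells whose faces are all based in [D]. Hence the windows: one finite set of
    group elements per degree, chosen so that the faces of a cell interior in degree j+1 are
    interior in degree j. This makes [Y] a subcomplex on which the transported homotopy inherits the
    identities of [s]. Only [Xi] and [expand] involve [s], and a weak rebuilding bounds neither of
    them; it bounds ranks, the new differential and [collapse]. So [kappa] is fixed from [X] before
    [T] and the chain are given, and [T] enters only through the choice of [D]. The Folner constant
    is 1/(2T): half of the allowed rank pays for the boundary cells, the other half for the extra
    generator, which is affordable because the group is infinite and |D| can be forced above 2T. *)

Section RandomOrder.
Context (N : nat).
Local Open Scope set_scope.
Implicit Types (s : {perm 'I_N}) (A : {set 'I_N}) (a b : 'I_N).

(** A permutation is read as a total order on coset indices, [s a] being the rank of [a]. *)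
Definition minimizes s A a := (a \in A) && [forall b in A, (s a <= s b)%N].

Lemma minimizesP s A a :
  reflect (a \in A /\ forall b, b \in A -> (s a <= s b)%N) (minimizes s A a).
Proof.
apply: (iffP andP) => -[aA h]; split => //; first exact/forall_inP.
exact/forall_inP.
Qed.

Lemma minimizes_uniq s A a b : minimizes s A a -> minimizes s A b -> a = b.
Proof.
move=> /minimizesP[aA ha] /minimizesP[bA hb].
apply: (@perm_inj _ s); apply/val_inj/eqP.
by rewrite eqn_leq /= ha // hb.
Qed.

Lemma minimizes_exists s A a : a \in A -> exists b, minimizes s A b.
Proof.
move=> aA; case: (arg_minnP (fun b => s b : nat) aA) => b bA hb.
by exists b; apply/minimizesP; split.
Qed.

(** Precomposing with the transposition of [a] and [b] injects the orders with minimum at [a] into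
    those with minimum at [b]. *)
Lemma card_minimizes A a b : a \in A -> b \in A ->
  (#|[set s | minimizes s A a]| <= #|[set s | minimizes s A b]|)%N.
Proof.
move=> aA bA; rewrite -(card_imset _ (mulgI (tperm a b))).
apply/subset_leq_card/fintype.subsetP => _ /imsetP[s + ->].
rewrite !inE => /minimizesP[_ ha]; apply/minimizesP; split=> // c cA.
rewrite !permM tpermR; apply: ha.
by case: tpermP => // ->.
Qed.

(** By symmetry every element of [A] is the minimum for the same number [m] of orders, and these
    families of orders are disjoint. So the minimum of [A] lies in [A'] with probability at most
    |A'|/|A|, written here without denominators. *)
Lemma card_minimizes_in A A' : A' \subset A ->
  (#|[set s | [exists a in A', minimizes s A a]]| * #|A|
     <= #|A'| * #|{perm 'I_N}|)%N.
Proof.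
move=> sA'A.
have [->|[a0 a0A]] := set_0Vmem A; first by rewrite cards0 muln0.
pose m := #|[set s | minimizes s A a0]|.
have mE a : a \in A -> #|[set s | minimizes s A a]| = m.
  by move=> aA; apply/eqP; rewrite eqn_leq !card_minimizes.
have le1 : (#|[set s | [exists a in A', minimizes s A a]]| <= #|A'| * m)%N.
  rewrite -sum_nat_const -sum1_card big_mkcond /=.
  rewrite (eq_bigr (fun a => \sum_s minimizes s A a)%N); last first.
    move=> a /(fintype.subsetP sA'A) /mE <-.
    by rewrite -sum1_card big_mkcond; apply: eq_bigr => s _; rewrite inE; case: ifP.
  rewrite exchange_big /=; apply: leq_sum => s _.
  rewrite inE; case: ifP => // /exists_inP[a aA' sa].
  by rewrite (bigD1 a) //= sa.
have le2 : (m * #|A| <= #|{perm 'I_N}|)%N.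
  rewrite mulnC -sum_nat_const -(eq_bigr _ mE).
  under eq_bigr do rewrite -sum1_card big_mkcond /=.
  rewrite exchange_big /= -sum1_card; apply: leq_sum => s _.
  have [b mb] := minimizes_exists s a0A.
  have /minimizesP[bA _] := mb.
  rewrite (bigD1 b) //= inE mb big1 // => a /andP[_ ab]; rewrite inE.
  case: ifP => // ma; move: ab.
  by rewrite (minimizes_uniq ma mb) eqxx.
apply: leq_trans (leq_mul le1 (leqnn _)) _.
by rewrite -mulnA leq_mul.
Qed.

End RandomOrder.

Section Subgroups.
Context (G : groupType) (L : set G).
Local Open Scope group_scope.

Lemma subgroupV x : subgroup L -> L x -> L x^-1.
Proof. by move=> [L1 Ld] Lx; rewrite -[x^-1]mul1g; exact: Ld. Qed.

Lemma subgroupM x y : subgroup L -> L x -> L y -> L (x * y).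
Proof.
by move=> sL Lx Ly; rewrite -[y]invgK; apply: (proj2 sL) => //; exact: subgroupV.
Qed.

(** [finite_index] counts left cosets; by normality two of them agree exactly when [g * h^-1] is in
    [L], so the same numbering serves the right cosets [L g] used below. *)
Lemma coset_index : normal_subgroup L -> finite_index L ->
  exists N (idx : G -> 'I_N) (pick : 'I_N -> G),
    (forall i, idx (pick i) = i) /\
    (forall g h, idx g = idx h <-> L (g * h^-1)).
Proof.
move=> [sL nL] fL.
pose c (g : G) := [set g * h | h in L]%classic.
pose X : {fset set G} := fset_set (range c).
have cX g : c g \in X by rewrite in_fset_set // inE; exists g.
pose idx g := enum_rank [` cX g]%fset.
have idxP g h : idx g = idx h <-> c g = c h.
  split=> [/enum_rank_inj|e]; first by move/(congr1 val).
  by congr enum_rank; apply/val_inj.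
have cP g h : c g = c h <-> L (g * h^-1).
  split=> [e|Lgh].
    have : c h g by rewrite -e; exists 1; [exact: (proj1 sL)|rewrite mulg1].
    by case=> l Ll <-; have := nL _ h^-1 Ll; rewrite conjgE invgK mulgA.
  have LVgh : L (h^-1 * g).
    by have := nL _ h Lgh; rewrite conjgE !mulgA mulgVK.
  apply/seteqP; split=> _ [l Ll <-].
    exists (h^-1 * g * l); first exact: subgroupM.
    by rewrite !mulgA mulgV mul1g.
  exists (g^-1 * h * l); last by rewrite !mulgA mulgV mul1g.
  apply: subgroupM => //; have := subgroupV sL LVgh.
  by rewrite invgM invgK.
have /choice[pick pickP] i : exists g, idx g = i.
  have : val (enum_val i) \in X by exact: valP.
  rewrite in_fset_set // inE => -[g _ cg]; exists g.
  by apply: enum_val_inj; rewrite enum_rankK; apply/val_inj.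
exists #|{: X}|, idx, pick; split=> // g h.
exact: iff_trans (idxP _ _) (cP _ _).
Qed.

End Subgroups.

Section ResidualChains.
Context (G : groupType) (L : nat -> set G).
Hypothesis rL : residual_chain L.
Local Open Scope group_scope.

Lemma residual_chain_le i j : (i <= j)%N -> L j `<=` L i.
Proof.
case: rL => _ dL _ _ ij; elim: j ij => [|j IHj]; first by rewrite leqn0 => /eqP->.
rewrite leq_eqVlt => /predU1P[->//|]; rewrite ltnS => /IHj.
exact: subset_trans (dL j).
Qed.

Lemma residual_chain_avoid (E : {fset G}) :
  exists i0, forall i, (i0 <= i)%N -> forall g, g \in E -> L i g -> g = 1.
Proof.
have /choice[k kP] g : exists i, L i g -> g = 1.
  have [->|g1] := pselect (g = 1); first by exists 0.
  apply: contra_notP g1 => h; case: rL => _ _ _ iL.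
  suff : (\bigcap_i L i) g by rewrite iL.
  by move=> i _; apply: contra_notP h => nLi; exists i.
exists (\max_(g <- E) k g)%N => i le g gE Lg; apply: kP.
apply: residual_chain_le Lg; apply: leq_trans le.
by rewrite (big_fsetD1 g gE) /= leq_maxl.
Qed.

Lemma residual_chain_separates (E : {fset G}) :
  exists i0, forall i, (i0 <= i)%N ->
    forall g h, g \in E -> h \in E -> L i (g * h^-1) -> g = h.
Proof.
have [i0 Hi] := residual_chain_avoid [fset g * h^-1 | g in E, h in E]%fset.
exists i0 => i le g h gE hE /(Hi i le _ (in_imfset2 _ _ gE hE)) /= e.
by rewrite -[h]mul1g -e mulgVK.
Qed.

End ResidualChains.

Section OrderedLift.
Context (G : groupType) (L : set G) (F : {fset G}).
Context (N : nat) (idx : G -> 'I_N) (pick : 'I_N -> G).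
Hypothesis nL : normal_subgroup L.
Hypothesis pickK : forall i, idx (pick i) = i.
Hypothesis idxP : forall g h, idx g = idx h <-> L (g * h^-1)%g.
Hypothesis F_neq0 : F != fset0.
Local Open Scope group_scope.

Definition first_hit (s : {perm 'I_N}) (x : G) : G :=
  xget 1 [set f | f \in F /\
    forall f', f' \in F -> (s (idx (x * f)) <= s (idx (x * f')))%N]%classic.

(** Jump from the coset of [x] to the earliest coset of [x F], take its chosen representative there,
    and jump back. Cosets with the same earliest neighbour [i] are thus lifted into one translate
    [pick i * F^-1]. *)
Definition ordered_lift s x : G := pick (idx (x * first_hit s x)) * (first_hit s x)^-1.

Definition index_set (x : G) (E : {fset G}) : {set 'I_N} :=
  [set i in [seq idx (x * u) | u <- E]]%SET.

Lemma index_setP x (E : {fset G}) i :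
  reflect (exists2 u, u \in E & i = idx (x * u)) (i \in index_set x E).
Proof. by rewrite inE; apply: mapP. Qed.

Lemma first_hitP s x : first_hit s x \in F /\
  forall f, f \in F -> (s (idx (x * first_hit s x)) <= s (idx (x * f)))%N.
Proof.
have [f0 f0F] := fset0Pn F F_neq0.
have i0 : idx (x * f0) \in index_set x F by apply/index_setP; exists f0.
have [i /minimizesP[/index_setP[f fF ->] hi]] := minimizes_exists s i0.
apply: (@xgetPex _ 1 [set f | f \in F /\
    forall f', f' \in F -> (s (idx (x * f)) <= s (idx (x * f')))%N]%classic).
by exists f; split=> // f' f'F; apply: hi; apply/index_setP; exists f'.
Qed.

Lemma idx_mulr x y g : idx x = idx y -> idx (x * g) = idx (y * g).
Proof.
move=> /idxP Lxy; apply/idxP.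
by rewrite invgM mulgA -[x * g * g^-1]mulgA mulgV mulg1.
Qed.

Lemma idx_inj x u v : idx (x * u) = idx (x * v) -> L (u * v^-1).
Proof.
move=> /idxP; have [_ nLx] := nL => /(nLx _ x).
by rewrite conjgE invgM !mulgA mulVg mul1g mulgVK.
Qed.

Lemma idx_ordered_lift s x : idx (ordered_lift s x) = idx x.
Proof.
rewrite -[in RHS](mulgK (first_hit s x) x).
by apply: idx_mulr; rewrite pickK.
Qed.

Lemma ordered_lift_idx s x y : idx x = idx y -> ordered_lift s x = ordered_lift s y.
Proof.
move=> exy; rewrite /ordered_lift.
suff -> : first_hit s x = first_hit s y by rewrite (idx_mulr _ exy).
rewrite /first_hit; congr (xget _ _); apply/seteqP; split=> f [fF hf];
  split=> // f' f'F; move: (hf _ f'F).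
  by rewrite !(idx_mulr _ exy).
by rewrite !(idx_mulr _ (esym exy)).
Qed.

(** Let [u] be the element of the union of [F] and [tF] for which the coset of [x u] comes first; by
    injectivity it is unique. If [u] lies in both sets, it is the first hit from [x], and [t^-1 u]
    is the first hit from [x t], so both lifts go back from the same representative. *)
Lemma ordered_lift_mulr s x t (tF := [fset t * f | f in F]%fset) :
  (forall u v, u \in (F `|` tF)%fset -> v \in (F `|` tF)%fset -> L (u * v^-1) -> u = v) ->
  ~~ [exists i in index_set x ((tF `\` F) `|` (F `\` tF))%fset,
       minimizes s (index_set x (F `|` tF)%fset) i] ->
  ordered_lift s (x * t) = ordered_lift s x * t.
Proof.
move=> inj nbad; set U := (F `|` tF)%fset in inj nbad.
have [f0 f0F] := fset0Pn F F_neq0.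
have i0 : idx (x * f0) \in index_set x U.
  by apply/index_setP; exists f0 => //; rewrite in_fsetU f0F.
have [i mi] := minimizes_exists s i0.
have /minimizesP[/index_setP[u uU ei] hi] := mi.
have uniq v : v \in U -> (s (idx (x * v)) <= s i)%N -> v = u.
  move=> vU le; apply: inj => //; apply: (@idx_inj x); rewrite -ei.
  apply: (@perm_inj _ s); apply/val_inj/eqP; rewrite eqn_leq le hi //.
  by apply/index_setP; exists v.
have /andP[uF utF] : (u \in F) && (u \in tF).
  move: nbad; apply: contraNT => nu; apply/exists_inP; exists i => //.
  apply/index_setP; exists u => //; move: uU nu.
  by rewrite /U !inE; case: (u \in F); case: (u \in tF).
have [f1F h1] := first_hitP s x.
have [f2F h2] := first_hitP s (x * t).
have e1 : first_hit s x = u.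
  apply: uniq; first by rewrite in_fsetU f1F.
  by rewrite ei h1.
have e2 : t * first_hit s (x * t) = u.
  apply: uniq; first by rewrite in_fsetU; apply/orP; right; exact: in_imfset.
  move: utF => /imfsetP[/= f fF eu].
  by rewrite mulgA ei eu mulgA h2.
have e3 : (first_hit s (x * t))^-1 = u^-1 * t by rewrite -e2 invgM mulgVK.
by rewrite /ordered_lift e1 -mulgA e2 e3 mulgA.
Qed.

End OrderedLift.

Lemma exists_le_average (R : realFieldType) (T : finType) (t0 : T) (f : T -> R) (c : R) :
  \sum_t f t <= c * #|T|%:R -> exists t, f t <= c.
Proof.
move=> le; apply: contrapT => /forallNP h.
suff : c * #|T|%:R < \sum_t f t by rewrite ltNge le.
rewrite mulr_natr -sumr_const; apply: ltr_sum.
  by apply/hasP; exists t0; rewrite ?mem_index_enum.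
by move=> t _; rewrite ltNge; apply/negP/h.
Qed.

Section IndexSetCard.
Context (G : groupType) (N : nat) (idx : G -> 'I_N).

Lemma card_index_set_le x (E : {fset G}) : (#|index_set idx x E| <= #|` E|)%N.
Proof. by rewrite cardsE; apply: leq_trans (card_size _) _; rewrite size_map. Qed.

Lemma card_index_set_ge x (E E' : {fset G}) :
  {in E &, injective (fun u => idx (x * u)%g)} -> {subset E <= E'} ->
  (#|` E| <= #|index_set idx x E'|)%N.
Proof.
move=> inj sub; have <- : #|index_set idx x E| = #|` E|.
  rewrite cardsE -(size_map (fun u => idx (x * u)%g) (enum_fset E)).
  by apply/card_uniqP; rewrite map_inj_in_uniq ?fset_uniq.
apply/subset_leq_card/fintype.subsetP => i /index_setP[u uE ->].
by apply/index_setP; exists u => //; exact: sub.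
Qed.

End IndexSetCard.

(* Weiss: in an amenable group the large quotients of a residual chain admit
   Folner transversals. Order the cosets at random and send the coset of x to
   the first of the cosets of xF, which is then lifted back along F; the lifts
   of x and xs disagree only if the first element of xF `|` xsF lies in the
   symmetric difference, which has probability at most |F \triangle sF| / |F|. *)
Lemma folner_transversal (R : realType) (G : groupType) (L : nat -> set G) :
  amenable R G -> infinite_set [set: G] -> residual_chain L ->
  forall (S : {fset G}) (e : R) (M : nat), 0 < e ->
  exists i0 : nat, forall i, (i0 <= i)%N -> exists D : {fset G},
    [/\ forall g, exists2 d, d \in D & L i (d * g^-1)%g,
        forall d d', d \in D -> d' \in D -> L i (d * d'^-1)%g -> d = d',
        (M <= #|` D|)%N &
        #|` [fset x in D | ~~ all (fun s => (x * s)%g \in D) S]%fset |%:R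
          <= e * #|` D|%:R].
Proof.
move=> amG infG rL S e M e0.
(* The failures for the elements of [S] will be added up, so each gets an equal share of [e]; m+1
   keeps the divisor nonzero. *)
pose m := #|` S|; pose e' := e / m.+1%:R.
have e'0 : 0 < e' by rewrite divr_gt0.
have [F [F_neq0 hF]] := amG S e' e'0.
(* At least [M] elements, which will have distinct cosets: this forces the index, which is |D|, to
   be at least [M]. *)
have [E _ ME] := infinite_set_fset M infG.
pose SF := [fset (s * f)%g | s in S, f in F]%fset.
pose W := (F `|` SF `|` E)%fset.
have [i0 Hi] := residual_chain_separates rL W; exists i0 => i le.
have sep := Hi i le.
have [_ _ /(_ i)[nL fL] _] := rL.
have [N [idx [pick [pickK idxP]]]] := coset_index nL fL.
have idxW x : {in W &, injective (fun u => idx (x * u)%g)}.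
  by move=> u v uW vW /(idx_inj nL idxP); exact: sep.
have EN : (#|` E| <= N)%N.
  rewrite -[leqRHS]card_ord; apply: leq_trans (max_card (mem (index_set idx 1%g E))).
  apply: card_index_set_ge => // u v uE vE; apply: idxW;
    by rewrite /W in_fsetU ?uE ?vE orbT.
pose sF s := [fset (s * f)%g | f in F]%fset.
pose De s := ((sF s `\` F) `|` (F `\` sF s))%fset.
pose bad (sg : {perm 'I_N}) j s := [exists k in index_set idx (pick j) (De s),
  minimizes sg (index_set idx (pick j) (F `|` sF s)%fset) k].
have subW s u : s \in S -> u \in (F `|` sF s)%fset -> u \in W.
  move=> sS; rewrite /W !in_fsetU => /orP[->//|/imfsetP[/= f fF ->]].
  by rewrite (_ : _ \in SF) ?orbT //; apply/imfset2P; exists s => //; exists f.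
have card_bad j s : s \in S ->
    (\sum_sg bad sg j s)%N%:R <= e' * #|{perm 'I_N}|%:R :> R.
  move=> sS.
  (* The cosets of [x F] are distinct, so the Folner bound relative to |F| is also one relative to
     the number of cosets in [A]. *)
  have FA : (#|` F| <= #|index_set idx (pick j) (F `|` sF s)%fset|)%N.
    apply: card_index_set_ge => [u v uF vF|u uF]; last by rewrite in_fsetU uF.
    by apply: idxW; apply: (subW s) => //; rewrite in_fsetU ?uF ?vF.
  have F0 : (0 < #|` F|)%N by rewrite cardfs_gt0.
  have A0 := leq_trans F0 FA.
  set A := index_set _ _ _ in FA A0.
  have sub : index_set idx (pick j) (De s) \subset A.
    apply/fintype.subsetP => k /index_setP[u uD ->]; apply/index_setP; exists u => //.
    by move: uD; rewrite /De !inE => /orP[/andP[_ ->]|/andP[_ ->]]; rewrite ?orbT.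
  have le1 : ((\sum_sg bad sg j s) * #|A| <= #|` De s| * #|{perm 'I_N}|)%N.
    apply: leq_trans (leq_mul (card_index_set_le idx (pick j) (De s)) (leqnn _)).
    apply: leq_trans (card_minimizes_in sub); rewrite leq_mul2r; apply/orP; right.
    by rewrite -sum1_card [leqRHS]big_mkcond; apply: leq_sum => sg _; rewrite inE -/(bad sg j s); case: bad.
  rewrite -(ler_pM2r (_ : 0 < #|A|%:R)) ?ltr0n // -natrM.
  apply: (@le_trans _ _ (#|` De s| * #|{perm 'I_N}|)%:R); first by rewrite ler_nat.
  rewrite natrM mulrAC ler_wpM2r //; apply: le_trans (hF s sS) _.
  by rewrite ler_wpM2l ?(ltW e'0) // ler_nat.
have total : \sum_(sg : {perm 'I_N}) (\sum_(j < N) \sum_(s <- S) bad sg j s)%N%:R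
    <= e * N%:R * #|{perm 'I_N}|%:R :> R.
  rewrite -natr_sum exchange_big /=; under eq_bigr do rewrite exchange_big /=.
  rewrite natr_sum.
  apply: (@le_trans _ _ (\sum_(j < N) e * #|{perm 'I_N}|%:R)); last first.
    by rewrite sumr_const card_ord -[leLHS]mulr_natr mulrAC.
  apply: ler_sum => j _; rewrite natr_sum big_seq.
  apply: (@le_trans _ _ (\sum_(s <- S | s \in S) e' * #|{perm 'I_N}|%:R)).
    by apply: ler_sum => s sS; exact: card_bad.
  rewrite -big_seq big_const_seq count_predT iter_addr_0 -[leLHS]mulr_natr mulrAC.
  rewrite ler_wpM2r // /e' -mulrA ler_piMr ?(ltW e0) //.
  by rewrite mulrC ler_pdivrMr // mul1r ler_nat leqW.
(* First moment: some order has at most the average number of bad pairs (coset, element of [S]). *)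
have [sg hsg] := exists_le_average 1%g total.
pose lift := ordered_lift F idx pick sg.
have idx_lift x : idx (lift x) = idx x by exact: idx_ordered_lift.
have lift_idx x y : idx x = idx y -> lift x = lift y.
  exact: ordered_lift_idx.
pose D := [fset lift (pick j) | j : 'I_N]%fset.
have liftD x : lift x \in D.
  by apply/imfsetP; exists (idx x) => //=; apply: lift_idx; rewrite pickK.
have inD x : x \in D -> lift x = x.
  by move=> /imfsetP[/= j _ ->]; apply: lift_idx; rewrite idx_lift.
have cardD : #|` D| = N.
  rewrite card_imfset /= ?size_enum_ord // => j k /(congr1 idx).
  by rewrite !idx_lift !pickK.
exists D; split.
- by move=> g; exists (lift g) => //; apply/idxP; rewrite idx_lift.
- move=> d d' dD d'D /idxP/lift_idx; by rewrite !inD.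
- by rewrite cardD; exact: leq_trans EN.
rewrite cardD; apply: le_trans hsg; rewrite ler_nat.
pose J := [set j : 'I_N | has (bad sg j) S]%SET.
apply: (@leq_trans #|J|); last first.
  rewrite -sum1_card [leqLHS]big_mkcond; apply: leq_sum => j _; rewrite inE.
  by case: hasP => // -[s sS b]; rewrite (big_fsetD1 s sS) /= b.
rewrite [leqRHS]cardE -[leqRHS](size_map (fun j => lift (pick j))); apply: uniq_leq_size => //.
move=> x; rewrite !inE /= => /andP[xD /allPn[s sS nxs]].
apply/mapP; exists (idx x); last by rewrite -[LHS]inD //; apply: lift_idx; rewrite pickK.
rewrite mem_enum inE; apply/hasP; exists s => //; apply: contraNT nxs => nb.
have H : lift (pick (idx x) * s)%g = (lift (pick (idx x)) * s)%g.
  apply: (ordered_lift_mulr pick nL idxP F_neq0 _ nb) => u v uU vU.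
  by apply: sep; exact: (subW s).
have exs : lift (pick (idx x)) = x by rewrite -[RHS]inD //; apply: lift_idx; rewrite pickK.
by rewrite exs in H; rewrite -H.
Qed.

(** * Bases and projective modules *)

Section LinearMaps.
Context (R : nzRingType).

Definition pack_linear (M N : lmodType R) (f : M -> N) (lf : linear f) : {linear M -> N} :=
  HB.pack f (GRing.isLinear.Build R M N *:%R f lf).

Section Extend.
Context (K : choiceType) (V : lmodType R) (f : K -> V).

Definition malg_extend (c : {malg R[K]}) : V := \sum_(k <- msupp c) c@_k *: f k.

Lemma malg_extendw (d : {fset K}) c : (msupp c `<=` d)%fset ->
  malg_extend c = \sum_(k <- d) c@_k *: f k.
Proof.
move=> le; rewrite /malg_extend (big_fset_incl _ le) // => k _ /mcoeff_outdom ->.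
by rewrite scale0r.
Qed.

Fact malg_extend_is_linear : linear malg_extend.
Proof.
move=> a c c'; pose d := (msupp c `|` msupp c')%fset.
rewrite (@malg_extendw d c) ?fsubsetUl // (@malg_extendw d c') ?fsubsetUr //.
rewrite (@malg_extendw d); last first.
  apply: fsubset_trans (msuppD_le _ _) _.
  by apply: fsetUSS; [exact: msuppZ_le|].
rewrite scaler_sumr -big_split; apply: eq_bigr => k _ /=.
by rewrite mcoeffD mcoeffZ scalerDl scalerA.
Qed.

HB.instance Definition _ := GRing.isLinear.Build R {malg R[K]} V _ malg_extend
  malg_extend_is_linear.

Lemma malg_extendU k : malg_extend << k >> = f k.
Proof.
by rewrite (malg_extendw msuppU_le) big_seq_fset1 mcoeffUU scale1r.
Qed.

End Extend.

Lemma malgE (K : choiceType) (c : {malg R[K]}) : c = malg_extend (fun k => << k >>) c.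
Proof.
rewrite [LHS]monalgE; apply: eq_bigr => k _; apply/malgP => k'.
by rewrite mcoeffZ !mcoeffU mulr_natr.
Qed.

Lemma eq_malg_linear (K : choiceType) (V : lmodType R) (f g : {linear {malg R[K]} -> V}) :
  (forall k, f << k >> = g << k >>) -> f =1 g.
Proof.
move=> fg c; rewrite (malgE c) !linear_sum; apply: eq_bigr => k _.
by rewrite !linearZ fg.
Qed.

End LinearMaps.

Section Bases.
Context (R : nzRingType) (M : lmodType R) (B : set M).

Lemma lincombE (c : {malg R[M]}) : lincomb c = malg_extend id c.
Proof. by []. Qed.

Lemma lincombU (b : M) : lincomb << b >> = b.
Proof. by rewrite lincombE malg_extendU. Qed.

Definition generates := forall x, exists c, expands B x c.

Lemma expandsD x y c d a : expands B x c -> expands B y d ->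
  expands B (a *: x + y) (a *: c + d).
Proof.
move=> [sc <-] [sd <-]; split; last by rewrite !lincombE linearP.
move=> k /= /(fsubsetP (msuppD_le _ _)); rewrite inE => /orP[|/sd //].
by move/(fsubsetP (msuppZ_le _ _))/sc.
Qed.

Lemma expandsU b : B b -> expands B b << b >>.
Proof.
move=> Bb; split; last exact: lincombU.
by move=> k /= /(fsubsetP msuppU_le); rewrite inE => /eqP ->.
Qed.

Lemma generatesP : generates <-> forall P : M -> Prop,
  P 0 -> (forall a x y, P x -> P y -> P (a *: x + y)) ->
  (forall b, B b -> P b) -> forall x, P x.
Proof.
split=> [gB P P0 PD PB x|ind]; last first.
  apply: ind.
  - by exists 0; split; rewrite ?lincombE ?linear0 // msupp0 => k /=; rewrite inE.
  - by move=> a x y [c xc] [d yd]; exists (a *: c + d); exact: expandsD.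
  - by move=> b Bb; exists << b >>; exact: expandsU.
have [c [sc <-]] := gB x; rewrite /lincomb big_seq_cond.
apply: (big_rec P) => // b y; rewrite andbT => bc Py.
by apply: PD => //; apply/PB/sc.
Qed.

Lemma eq_on_generators (V : lmodType R) (f g : {linear M -> V}) : generates ->
  (forall b, B b -> f b = g b) -> f =1 g.
Proof.
move=> /generatesP ind fg; apply: ind; rewrite ?linear0 //.
by move=> a x y fx fy; rewrite !linearP fx fy.
Qed.

(** The functional dual to [b0] reads off the coefficient at [b0] of any expansion, so expansions
    are unique. It turns a universal property, which supplies such functionals, into a basis. *)
Lemma basis_of_functionals : generates ->
  (forall b0, B b0 -> exists d : {linear M -> R^o}, forall b, B b -> d b = (b == b0)%:R) ->
  is_basis B.
Proof.
move=> gB dB x; have [c xc] := gB x; exists c; split=> // c' xc'.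
have coef b0 (bB : B b0) (d : {linear M -> R^o}) (hd : forall b, B b -> d b = (b == b0)%:R) e :
    expands B x e -> e@_b0 = d x.
  move=> [se <-]; rewrite /lincomb linear_sum (bigID (pred1 b0)) /=.
  rewrite [X in _ + X]big_seq_cond [X in _ + X]big1 ?addr0; last first.
    by move=> b /andP[/se Bb bb0]; rewrite linearZ /= hd // (negPf bb0) scaler0.
  have [b0e|b0e] := boolP (b0 \in msupp e).
    rewrite -big_filter filter_pred1_uniq ?fset_uniq // big_seq1.
    by rewrite linearZ /= hd // eqxx [_ *: _]mulr1.
  rewrite mcoeff_outdom // big_seq_cond big1 // => b /andP[be /eqP eb].
  by rewrite eb (negPf b0e) in be.
apply/malgP => b0; have [Bb|nBb] := pselect (B b0).
  by have [d hd] := dB b0 Bb; rewrite !(coef b0 Bb d hd).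
by rewrite !mcoeff_outdom //; apply/negP => h; apply: nBb;
  [apply: (proj1 xc')|apply: (proj1 xc)].
Qed.

Lemma basis_generates : is_basis B -> generates.
Proof. by move=> bB x; have [c [xc _]] := bB x; exists c. Qed.

Lemma coordinatesP x : is_basis B -> expands B x (coordinates B x).
Proof.
move=> bB; have [c [xc _]] := bB x.
exact: (@xgetPex _ 0 [set c | expands B x c] (ex_intro _ c xc)).
Qed.

Lemma coordinatesE x c : is_basis B -> expands B x c -> coordinates B x = c.
Proof.
move=> bB xc; have [d [_ dq]] := bB x.
by rewrite -(dq _ (coordinatesP x bB)) -(dq _ xc).
Qed.

Lemma coordinates_linear : is_basis B -> linear (coordinates B).
Proof.
move=> bB a x y; apply: coordinatesE => //.
by apply: expandsD; exact: coordinatesP.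
Qed.

Lemma basis_extend (V : lmodType R) (phi : M -> V) : is_basis B ->
  exists f : {linear M -> V}, forall b, B b -> f b = phi b.
Proof.
move=> bB.
have lf : linear (malg_extend phi \o coordinates B).
  by move=> a x y; rewrite /= coordinates_linear // linearP.
exists (pack_linear lf) => b Bb /=.
by rewrite (coordinatesE bB (expandsU Bb)) malg_extendU.
Qed.

Lemma finite_basis_generates : finite_set B -> is_basis B -> finitely_generated M.
Proof.
move=> fB bB; exists (fset_set B) => x.
by rewrite fset_setK //; exact: basis_generates.
Qed.

End Bases.

Lemma basis_malg (R : nzRingType) (K : choiceType) :
  is_basis (range (fun k : K => << k >> : {malg R[K]})).
Proof.
apply: basis_of_functionals.
  apply/generatesP => P P0 PD PB x; rewrite (malgE x).
  by apply: (big_rec P) => // k y _ Py; apply: PD => //; apply: PB; exists k.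
move=> _ [k _ <-].
have lc : linear (mcoeff k : {malg R[K]} -> R^o).
  by move=> a x y; rewrite mcoeffD mcoeffZ.
exists (pack_linear lc) => _ [k' _ <-] /=.
rewrite mcoeffU; congr (_ *+ nat_of_bool _).
apply/eqP/eqP => [-> //|/(congr1 (mcoeff k))].
rewrite !mcoeffU eqxx; case: eqP => // _ /eqP.
by rewrite mulr0n mulr1n eq_sym oner_eq0.
Qed.

Lemma basis_iso (R : nzRingType) (M N : lmodType R) (f : {linear M -> N})
    (g : {linear N -> M}) (B : set M) :
  cancel f g -> cancel g f -> is_basis B -> is_basis (f @` B).
Proof.
move=> fK gK bB; apply: basis_of_functionals.
  apply/generatesP => P P0 PD PB y; rewrite -(gK y); move: (g y).
  have /generatesP ind := basis_generates bB; apply: ind.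
  - by rewrite linear0.
  - by move=> a x x' Px Px'; rewrite linearP; exact: PD.
  - by move=> b Bb; apply: PB; exists b.
move=> _ [b0 Bb0 <-].
have [d hd] := basis_extend (fun b : M => (b == b0)%:R : R^o) bB.
have ld : linear (d \o g) by move=> a x y; rewrite /= !linearP.
exists (pack_linear ld) => _ [b Bb <-] /=.
by rewrite fK hd // (can_eq fK).
Qed.

Section ProjectiveModules.
Context (R : nzRingType).
Implicit Types M N V : lmodType R.

Lemma finitely_generatedP M :
  finitely_generated M <-> exists2 S : set M, finite_set S & generates S.
Proof.
split=> [[S gS]|[S fS gS]]; first by exists [set` S] => //; exact: finite_fset.
by exists (fset_set S) => x; rewrite fset_setK.
Qed.

Lemma generates_image M N (f : {linear M -> N}) (S : set M) :
  (forall y, exists x, f x = y) -> generates S -> generates (f @` S).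
Proof.
move=> sf /generatesP ind; apply/generatesP => P P0 PD PB y.
have [x <-] := sf y; move: x; apply: ind; first by rewrite linear0.
  by move=> a x x' Px Px'; rewrite linearP; exact: (PD).
by move=> b Sb; apply: PB; exists b.
Qed.

Lemma fg_image M N (f : {linear M -> N}) : (forall y, exists x, f x = y) ->
  finitely_generated M -> finitely_generated N.
Proof.
move=> sf /finitely_generatedP[S fS gS]; apply/finitely_generatedP.
by exists (f @` S); [exact: finite_image|exact: generates_image].
Qed.

Lemma inl_linear M N : linear (fun x : M => (x, 0) : M * N).
Proof. by move=> a x y; congr pair; rewrite /= scaler0 addr0. Qed.

Lemma inr_linear M N : linear (fun x : N => (0, x) : M * N).
Proof. by move=> a x y; congr pair; rewrite /= scaler0 addr0. Qed.

Lemma pairDE M N (u : M * N) : u = (u.1, 0) + (0, u.2).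
Proof. by case: u => x y; congr pair; rewrite /= ?addr0 ?add0r. Qed.

Lemma fg_prod M N : finitely_generated M -> finitely_generated N ->
  finitely_generated (M * N)%type.
Proof.
move=> /finitely_generatedP[S fS /generatesP indS].
move=> /finitely_generatedP[T fT /generatesP indT]; apply/finitely_generatedP.
exists ([set (x, 0) | x in S] `|` [set (0, y) | y in T]).
  by rewrite finite_setU; split; exact: finite_image.
apply/generatesP => P P0 PD PB u; rewrite (pairDE u) -[X in X + _]scale1r.
apply: (PD); [move: u.1; apply: indS|move: u.2; apply: indT] => //.
- move=> a x y Px Py; rewrite [X in P X](inl_linear N a x y); exact: (PD).
- by move=> b Sb; apply: PB; left; exists b.
- move=> a x y Px Py; rewrite [X in P X](inr_linear M a x y); exact: (PD).
- by move=> b Tb; apply: PB; right; exists b.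
Qed.

Lemma basis_projective M (B : set M) : is_basis B -> projective M.
Proof.
move=> bB N Q p f sp.
have /choice[h hP] b : exists x, p x = f b by exact: sp.
have [g gP] := basis_extend h bB; exists g => x.
have lpg : linear (p \o g) by move=> a y z; rewrite /= !linearP.
apply: (eq_on_generators (f := pack_linear lpg) (basis_generates bB)) => b Bb.
by rewrite /= gP.
Qed.

Lemma retract_projective M N (i : {linear M -> N}) (r : {linear N -> M}) :
  cancel i r -> projective N -> projective M.
Proof.
move=> iK pN N' Q p f sp.
have lfr : linear (f \o r) by move=> a y z; rewrite /= !linearP.
have [g gP] := pN _ _ _ (pack_linear lfr) sp.
have lgi : linear (g \o i) by move=> a y z; rewrite /= !linearP.
by exists (pack_linear lgi) => x; rewrite /= gP /= iK.
Qed.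

Lemma prod_projective M N : projective M -> projective N -> projective (M * N)%type.
Proof.
move=> pM pN N' Q p f sp.
have l1 : linear (fun x : M => f (x, 0)).
  by move=> a y z; rewrite inl_linear linearP.
have l2 : linear (fun x : N => f (0, x)).
  by move=> a y z; rewrite inr_linear linearP.
have [g1 g1P] := pM _ _ _ (pack_linear l1) sp.
have [g2 g2P] := pN _ _ _ (pack_linear l2) sp.
have lg : linear (fun u : M * N => g1 u.1 + g2 u.2).
  by move=> a u v; rewrite !linearP scalerDr addrACA.
exists (pack_linear lg) => u.
by rewrite /= linearD g1P g2P /= -linearD -pairDE.
Qed.

Section Kernel.
Context (M N : lmodType R) (f : {linear M -> N}).

Definition ker_pred : pred M := [pred x | f x == 0].

Fact ker_pred_closed : submod_closed ker_pred.
Proof.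
split=> [|a x y]; first by rewrite inE linear0.
by rewrite !inE linearP => /eqP-> /eqP->; rewrite scaler0 addr0.
Qed.

HB.instance Definition _ := GRing.isSubmodClosed.Build R M ker_pred
  (GRing.submod_closed_semi ker_pred_closed).

Record kernel := Kernel { kernel_val :> M; _ : kernel_val \in ker_pred }.

HB.instance Definition _ := [isSub for @kernel_val].
HB.instance Definition _ := [Choice of kernel by <:].
HB.instance Definition _ := [SubChoice_isSubLmodule of kernel by <:].

End Kernel.

(** A free module [F] on generators of [M] splits as [M] times the kernel of [F -> M]. The kernel is
    projective as a retract of [F], and finitely generated as an image of [F] when the generating
    set is finite. If [M] is not finitely generated, all of [M] serves as generating set. *)
Lemma projective_complement M : projective M ->
  exists (C : lmodType R) (B : set (M * C)),
    [/\ projective C, is_basis B &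
        finitely_generated M -> finite_set B /\ finitely_generated C].
Proof.
move=> pM.
have [S [gS fS]] : exists S : set M, generates S /\ (finitely_generated M -> finite_set S).
  have [/finitely_generatedP[S fS gS]|nf] := pselect (finitely_generated M).
    by exists S.
  exists setT; split=> //; apply/generatesP => P _ _ PB x; exact: PB.
pose K := {x : M | x \in S}.
pose F : lmodType R := {malg R[K]}.
pose p : {linear F -> M} := malg_extend (val : K -> M).
have p_surj y : exists x, p x = y.
  move: gS y => /generatesP ind; apply: ind; first by exists 0; rewrite linear0.
    by move=> a _ _ [x <-] [y <-]; exists (a *: x + y); rewrite linearP.
  move=> b Sb; exists << (Sub b (mem_set Sb) : K) >>.
  exact: malg_extendU.
have [s ps] := pM _ _ p idfun p_surj.
have q_sub x : x - s (p x) \in ker_pred p.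
  by rewrite inE linearB /= ps subrr.
have lq : linear (fun x => Kernel (q_sub x)).
  move=> a x y; apply/val_inj; rewrite /= !linearP /= addrACA.
  by rewrite scalerDr.
pose q : {linear F -> kernel p} := pack_linear lq.
have pv (c : kernel p) : p (val c) = 0 by apply/eqP; have := valP c; rewrite inE.
have lv : linear (val : kernel p -> F) by move=> a x y; exact: linearP.
have qK : cancel (pack_linear lv) q.
  by move=> c; apply/val_inj; rewrite /= pv linear0 subr0.
have q_surj c : exists x, q x = c by exists (val c); exact: qK.
have lth : linear (fun x => (p x, q x)).
  by move=> a x y; congr pair; rewrite linearP.
have lth' : linear (fun u : M * kernel p => s u.1 + val u.2).
  by move=> a u v; rewrite !linearP /= scalerDr addrACA.
exists (kernel p), [set pack_linear lth b | b in range (fun k : K => << k >> : F)].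
have finB : finitely_generated M -> finite_set (range (fun k : K => << k >> : F)).
  move=> /fS fS'; apply: finite_image.
  apply: (sub_finite_set (B := (val : K -> M) @^-1` S)).
    by move=> k _ /=; apply/set_mem/(valP k).
  by apply: finite_preimage fS' => k k' _ _; exact: val_inj.
have bF : is_basis (range (fun k : K => << k >> : F)) by exact: basis_malg.
split.
- exact: retract_projective qK (basis_projective bF).
- apply: (basis_iso (g := pack_linear lth')) bF.
    by move=> x; rewrite /= addrC subrK.
  move=> [m c]; congr pair; first by rewrite /= linearD ps pv addr0.
  rewrite linearD; have -> : q (val c) = c by exact: qK.
  by rewrite (_ : q (s m) = 0) ?add0r //; apply/val_inj; rewrite /= ps subrr.
- move=> /finB fB; split; first exact: finite_image.
  by apply: (fg_image q_surj); exact: finite_basis_generates fB bF.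
Qed.

End ProjectiveModules.

(** * Free resolutions *)

Section FreeResolution.
Context (G : groupType).
Local Notation ZG := (group_ring G).
Context (P : chain_complex ZG) (pP : forall j, projective (P j)).

Let zero_module : lmodType ZG := {malg ZG[void]}.

Lemma zero_moduleE (x : zero_module) : x = 0.
Proof. by apply/malgP; case. Qed.

Lemma zero_projective : projective zero_module.
Proof. by apply: basis_projective; exact: basis_malg. Qed.

Definition complement (M : lmodType ZG) (pM : projective M) : lmodType ZG :=
  sval (cid (projective_complement pM)).

Lemma complementP (M : lmodType ZG) (pM : projective M) :
  exists B : set (M * complement pM),
    [/\ projective (complement pM), is_basis B &
        finitely_generated M -> finite_set B /\ finitely_generated (complement pM)].
Proof. exact: svalP (cid (projective_complement pM)). Qed.

Lemma complement_projective (M : lmodType ZG) (pM : projective M) :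
  projective (complement pM).
Proof. by have [B []] := complementP pM. Qed.

(* [filler j.+1] makes [P j * filler j] free, and is cancelled by the copy of
   itself that [free_module j.+1] contains. *)
Fixpoint filler (j : nat) : {C : lmodType ZG | projective C} :=
  match j with
  | 0 => exist _ zero_module zero_projective
  | j'.+1 =>
      let pM := prod_projective (@pP j') (svalP (filler j')) in
      exist _ (complement pM) (@complement_projective _ pM)
  end.

(** The last factor is the bottom of an elementary complex whose top is the middle factor one degree
    higher. Since [filler 0] is zero, no middle factor is left unmatched in degree 0. *)
Definition free_module (j : nat) : lmodType ZG :=
  ((P j * sval (filler j)) * sval (filler j.+1))%type.

Definition free_bd_fun j (u : free_module j.+1) : free_module j :=
  ((bd P j u.1.1, 0), u.1.2).

Lemma free_bd_linear j : linear (@free_bd_fun j).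
Proof.
move=> a u v; rewrite /free_bd_fun /= linearP.
by congr pair; congr pair; rewrite /= scaler0 addr0.
Qed.

Definition free_bd j : {linear free_module j.+1 -> free_module j} :=
  pack_linear (@free_bd_linear j).

Lemma free_bd_bd j (u : free_module j.+2) : free_bd j (free_bd j.+1 u) = 0.
Proof. by rewrite /= /free_bd_fun /= bd_bd. Qed.

Definition free_complex : chain_complex ZG := ChainComplex free_bd_bd.

Context (eta : {linear P 0%N -> trivial_module G}).

Lemma free_eta_linear : linear (fun u : free_module 0 => eta u.1.1).
Proof. by move=> a u v; rewrite linearP. Qed.

Definition free_eta : {linear free_complex 0%N -> trivial_module G} :=
  pack_linear free_eta_linear.

Lemma free_complex_basis n :
  (forall j, (j <= n)%N -> finitely_generated (P j)) ->
  exists B : forall j, set (free_complex j),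
    based_free B /\ forall j, (j <= n)%N -> finite_set (B j).
Proof.
move=> fP.
have fC j : (j <= n.+1)%N -> finitely_generated (sval (filler j)).
  elim: j => [_|j IHj jn].
    by apply/finitely_generatedP; exists set0 => // x;
      exists 0; split=> [k|]; rewrite ?msupp0 ?inE // lincombE linear0 [x]zero_moduleE.
  have [B [_ _ h]] := complementP (prod_projective (@pP j) (svalP (filler j))).
  by apply: (proj2 (h _)); apply: fg_prod; [exact: fP|exact: IHj (ltnW jn)].
have hB j : exists B : set (free_complex j), is_basis B /\ ((j <= n)%N -> finite_set B).
  have [B [_ bB h]] := complementP (prod_projective (@pP j) (svalP (filler j))).
  exists B; split=> // jn; apply: (proj1 (h _)); apply: fg_prod; first exact: fP.
  exact: fC (leqW jn).
exists (fun j => sval (cid (hB j))); split=> j; first exact: (proj1 (svalP (cid (hB j)))).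
exact: (proj2 (svalP (cid (hB j)))).
Qed.

Lemma free_complex_resolution : projective_resolution eta ->
  (exists B : forall j, set (free_complex j), based_free B) ->
  projective_resolution free_eta.
Proof.
move=> [_ eta_surj eta_ker exP] [B bB]; split.
- by move=> j; exact: basis_projective (bB j).
- by move=> a; have [x <-] := eta_surj a; exists ((x, 0), 0).
- move=> [[x c] d]; split=> [/= /eta_ker[y <-]|[u <-]] /=.
    by exists ((y, d), 0); rewrite /= /free_bd_fun /= [c]zero_moduleE.
  by apply/eta_ker; exists u.1.1.
- move=> j [[x c] d]; split=> [[/exP[y yx] c0]|[u <-]]; last exact: free_bd_bd.
  (* A cycle has [c = 0], and [d] is hit by its copy one degree higher. *)
  exists ((y, d), 0); rewrite /= /free_bd_fun /= yx.
  by congr pair; congr pair.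
Qed.

End FreeResolution.

Lemma based_resolution (n : nat) (G : groupType) : FP n G ->
  exists (X : chain_complex (group_ring G))
         (eta : {linear X 0%N -> trivial_module G})
         (B : forall j, set (X j)),
    [/\ projective_resolution eta, based_free B &
        forall j, (j <= n)%N -> finite_set (B j)].
Proof.
move=> [P [eta [rP fP]]]; have [pP _ _ _] := rP.
have [B [bB fB]] := free_complex_basis pP fP.
exists (free_complex pP), (free_eta pP eta), B; split=> //.
by apply: free_complex_resolution => //; exists B.
Qed.

(** * Collapsing a subcomplex *)

Section L1Norm.
Context (M : lmodType int) (B : set M).
Hypothesis bB : is_basis B.

Let coordinates_map : {linear M -> {malg int[M]}} := pack_linear (coordinates_linear bB).

Lemma l1_normw (d : {fset M}) x : (msupp (coordinates B x) `<=` d)%fset ->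
  l1_norm B x = (\sum_(b <- d) `|(coordinates B x)@_b|)%N.
Proof.
by move=> le; rewrite /l1_norm (big_fset_incl _ le) // => k _ /mcoeff_outdom ->.
Qed.

Lemma l1_norm0 : l1_norm B 0 = 0%N.
Proof.
rewrite /l1_norm (_ : coordinates B 0 = 0) ?msupp0 ?big_seq_fset0 //.
exact: (linear0 coordinates_map).
Qed.

Lemma l1_normD x y : (l1_norm B (x + y) <= l1_norm B x + l1_norm B y)%N.
Proof.
have e : coordinates B (x + y) = coordinates B x + coordinates B y.
  exact: (linearD coordinates_map).
rewrite (@l1_normw (msupp (coordinates B x) `|` msupp (coordinates B y))%fset (x + y));
  last by rewrite e msuppD_le.
rewrite (l1_normw (fsubsetUl _ (msupp (coordinates B y)))).
rewrite (l1_normw (fsubsetUr (msupp (coordinates B x)) _)).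
rewrite -big_split; apply: leq_sum => b _ /=.
by rewrite e mcoeffD; lia.
Qed.

Lemma l1_normZ a x : (l1_norm B (a *: x) <= `|a| * l1_norm B x)%N.
Proof.
have e : coordinates B (a *: x) = a *: coordinates B x.
  by rewrite -[LHS]/(coordinates_map _) linearZ.
rewrite (@l1_normw (msupp (coordinates B x)) (a *: x)); last by rewrite e msuppZ_le.
rewrite /l1_norm big_distrr; apply: leq_sum => b _ /=.
by rewrite e mcoeffZ abszM.
Qed.

Lemma l1_norm_basis b : B b -> (l1_norm B b <= 1)%N.
Proof.
move=> Bb; rewrite /l1_norm (coordinatesE bB (expandsU Bb)).
by rewrite msuppU oner_eq0 big_seq_fset1 mcoeffUU.
Qed.

Lemma l1_norm_sum (I : Type) (s : seq I) (v : I -> M) :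
  (l1_norm B (\sum_(i <- s) v i) <= \sum_(i <- s) l1_norm B (v i))%N.
Proof.
apply: (big_ind2 (fun x (m : nat) => l1_norm B x <= m)%N) => //; first by rewrite l1_norm0.
by move=> x m y m' xm ym; apply: leq_trans (l1_normD _ _) _; exact: leq_add.
Qed.

End L1Norm.

Lemma l1_norm_linear (M N : lmodType int) (B : set M) (C : set N)
    (f : {linear M -> N}) (k : nat) : is_basis B -> is_basis C ->
  (forall b, B b -> (l1_norm C (f b) <= k)%N) ->
  forall x, (l1_norm C (f x) <= k * l1_norm B x)%N.
Proof.
move=> bB bC hf x; have [sc e] := coordinatesP x bB.
rewrite -[in f x]e /lincomb linear_sum.
under eq_bigr do rewrite linearZ.
apply: leq_trans (l1_norm_sum bC _ _) _.
rewrite /l1_norm big_distrr /= big_seq [leqRHS]big_seq.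
apply: leq_sum => b /sc Bb; apply: leq_trans (l1_normZ bC _ _) _.
by rewrite mulnC leq_mul // hf.
Qed.

Lemma operator_norm_le (R : realType) (M N : lmodType int) (B : set M) (C : set N)
    (f : {linear M -> N}) (k : nat) (c : R) : is_basis B -> is_basis C ->
  (forall b, B b -> (l1_norm C (f b) <= k)%N) -> k%:R <= c ->
  (operator_norm R B C f <= c%:E)%E.
Proof.
move=> bB bC hf kc; apply: ub_ereal_sup => _ [x _ <-]; rewrite lee_fin.
have [->|] := posnP (l1_norm B x).
  by rewrite invr0 mulr0; apply: le_trans kc.
move=> x0; rewrite ler_pdivrMr ?ltr0n //.
apply: (@le_trans _ _ (k * l1_norm B x)%:R).
  by rewrite ler_nat; exact: l1_norm_linear.
by rewrite natrM ler_wpM2r.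
Qed.

Section Collapse.
Context (X : chain_complex int) (B : forall j, set (X j)) (bB : based_free B).
Context (Y : forall j, set (X j)).
Context (Xi : forall j, {linear X j -> X j.+1}).
Context (eps : forall j, X j -> int) (u : forall j, X j).

(** For any [Xi] this is a chain map homotopic to the identity. If on [Y] it equals [eps] times [u],
    it factors through the pushout of [X] along the map [eps] from [Y] to the integers in degree 0.
    That pushout is the complex [collapsed], [collapse] is the projection, and [expand] is the
    factorisation. *)
Definition deviation (j : nat) : {linear X j -> X j} :=
  match j with
  | 0 => idfun \- (bd X 0 \o Xi 0)
  | j'.+1 => idfun \- ((bd X j'.+1 \o Xi j'.+1) \+ (Xi j' \o bd X j'))
  end.

Lemma deviation_bd j x : deviation j (bd X j x) = bd X j (deviation j.+1 x).
Proof.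
case: j x => [|j] x /=; rewrite [RHS]linearB [X in _ = _ - X]linearD /= !bd_bd add0r //.
by rewrite linear0 addr0.
Qed.

(* [None] is an extra generator, present in degree 0 only. *)
Definition is_cell j (k : option (X j)) : bool :=
  if k is Some b then `[< B b /\ ~ Y b >] else j == 0%N.

Definition cell j : Type := {k : option (X j) | is_cell k}.
HB.instance Definition _ j := Choice.on (cell j).

Definition collapsed_module j : lmodType int := {malg int[cell j]}.

(** The value 0 off the cells makes the generator [None] vanish in positive degrees, so that
    [collapse_fun] is given by one formula in all degrees. *)
Definition cell_gen j (k : option (X j)) : collapsed_module j :=
  if insub k is Some k' then << (k' : cell j) >> else 0.

Lemma cell_genS j (k : cell j) : cell_gen (val k) = << k >>.
Proof. by rewrite /cell_gen valK. Qed.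

Lemma cell_genE j k (h : is_cell k) : cell_gen k = << (exist _ k h : cell j) >>.
Proof. exact: cell_genS (exist _ k h : cell j). Qed.

Definition collapse_fun j (b : X j) : collapsed_module j :=
  if `[< Y b >] then eps b *: cell_gen None else cell_gen (Some b).

Definition collapse j : {linear X j -> collapsed_module j} :=
  sval (cid (basis_extend (@collapse_fun j) (@bB j))).

Lemma collapseE j b : B b -> collapse j b = collapse_fun b.
Proof. exact: (svalP (cid (basis_extend (@collapse_fun j) (@bB j)))). Qed.

Definition collapsed_bd_fun j (k : cell j.+1) : collapsed_module j :=
  if val k is Some b then collapse j (bd X j b) else 0.

Definition collapsed_bd j : {linear collapsed_module j.+1 -> collapsed_module j} :=
  malg_extend (@collapsed_bd_fun j).

Definition expand_fun j (k : cell j) : X j :=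
  if val k is Some b then deviation j b else u j.

Definition expand j : {linear collapsed_module j -> X j} :=
  malg_extend (@expand_fun j).

Lemma collapsed_bdU j (k : cell j.+1) : collapsed_bd j << k >> = collapsed_bd_fun k.
Proof. exact: malg_extendU. Qed.

Lemma expandU j (k : cell j) : expand j << k >> = expand_fun k.
Proof. exact: malg_extendU. Qed.

Hypothesis Y_bd : forall j y, @Y j.+1 y -> collapse j (bd X j y) = 0.
Hypothesis Y_dev0 : forall y, @Y 0 y -> deviation 0 y = @eps 0 y *: u 0.
Hypothesis Y_devS : forall j y, @Y j.+1 y -> deviation j.+1 y = 0.

Lemma expand_collapse j x : expand j (collapse j x) = deviation j x.
Proof.
apply: (eq_on_generators (f := expand j \o collapse j) (basis_generates (@bB j))).
move=> b Bb; rewrite /= collapseE // /collapse_fun; case: asboolP => Yb.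
  rewrite linearZ; clear x; case: j b Bb Yb => [|j] b Bb Yb.
    rewrite Y_dev0 //; congr (_ *: _).
    by rewrite (@cell_genE 0 None isT) expandU.
  by rewrite Y_devS // /cell_gen insubF // linear0 /= scaler0.
have h : is_cell (Some b) by apply/asboolP.
by rewrite (cell_genE h) expandU.
Qed.

Lemma collapsed_bd_collapse j x :
  collapsed_bd j (collapse j.+1 x) = collapse j (bd X j x).
Proof.
apply: (eq_on_generators (f := collapsed_bd j \o collapse j.+1)
  (g := collapse j \o bd X j) (basis_generates (@bB j.+1))).
move=> b Bb; rewrite /= collapseE // /collapse_fun; case: asboolP => Yb.
  by rewrite Y_bd // /cell_gen insubF // /= scaler0 linear0.
have h : is_cell (Some b) by apply/asboolP.
by rewrite (cell_genE h) collapsed_bdU.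
Qed.

Lemma collapsed_bd_bd j x : collapsed_bd j (collapsed_bd j.+1 x) = 0.
Proof.
apply: (eq_malg_linear (f := collapsed_bd j \o collapsed_bd j.+1) (g := \0)) => k.
rewrite -[LHS]/(collapsed_bd j (collapsed_bd j.+1 << k >>)) collapsed_bdU.
case: k => -[b|] h; rewrite /collapsed_bd_fun [val _]/=.
  by rewrite collapsed_bd_collapse bd_bd linear0.
by rewrite linear0.
Qed.

Definition collapsed : chain_complex int := ChainComplex collapsed_bd_bd.

Lemma expand_bd j x : bd X j (expand j.+1 x) = expand j (collapsed_bd j x).
Proof.
apply: (eq_malg_linear (f := bd X j \o expand j.+1) (g := expand j \o collapsed_bd j)).
move=> k; rewrite -[LHS]/(bd X j (expand j.+1 << k >>)).
rewrite -[RHS]/(expand j (collapsed_bd j << k >>)) expandU collapsed_bdU.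
case: k => -[b|] h; rewrite /collapsed_bd_fun /expand_fun [val _]/=.
  by rewrite expand_collapse deviation_bd.
by rewrite linear0.
Qed.

Lemma collapse_htpy0 x : bd X 0 (Xi 0 x) = x - expand 0 (collapse 0 x).
Proof. by rewrite expand_collapse /= opprB [RHS]addrC subrK. Qed.

Lemma collapse_htpyS j x :
  bd X j.+1 (Xi j.+1 x) + Xi j (bd X j x) = x - expand j.+1 (collapse j.+1 x).
Proof. by rewrite expand_collapse /= opprB [RHS]addrC subrK. Qed.

Definition collapse_retract : homotopy_retract X collapsed :=
  @HomotopyRetract int X collapsed collapse expand Xi
    collapsed_bd_collapse expand_bd collapse_htpy0 collapse_htpyS.

Definition collapsed_basis j : set (collapsed j) :=
  range (fun k : cell j => << k >> : {malg int[cell j]}).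

Lemma collapsed_basisP : based_free collapsed_basis.
Proof. by move=> j; exact: basis_malg. Qed.

Lemma finite_cells j (Z : {fset X j}) : @B j `\` @Y j `<=` [set` Z] ->
  finite_set (@collapsed_basis j) /\
  (rank (@collapsed_basis j) <= #|` Z| + (j == 0))%N.
Proof.
move=> sZ.
pose W : {fset collapsed_module j} := [fset cell_gen (Some b) | b in Z]%fset.
pose W' := if j == 0%N then (cell_gen None |` W)%fset else W.
have sub : @collapsed_basis j `<=` [set` W'].
  move=> _ [[[b|] h] _ <-] /=; rewrite -cell_genS /W' /=.
    have bW : cell_gen (Some b) \in W.
      by apply: in_imfset; apply: sZ; apply/asboolP.
    by case: eqP => // _; rewrite in_fset1U bW orbT.
  by move: (h) => /= /[dup] /eqP j0 ->; rewrite in_fset1U eqxx.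
have fB : finite_set (@collapsed_basis j) by exact: sub_finite_set sub (finite_fset _).
split=> //; apply: (@leq_trans #|` W'|).
  apply: fsubset_leq_card; apply/fsubsetP => x; rewrite in_fset_set // inE.
  exact: sub.
have cW : (#|` W| <= #|` Z|)%N by exact: leq_imfset_card.
rewrite /W'; case: eqP => _; last by rewrite addn0.
by rewrite cardfsU1 addnC; apply: leq_add cW _; exact: leq_b1.
Qed.

(** A cell of [Y] goes to at most [E] times the extra generator and any other cell to itself; E+1
    covers both cases. *)
Lemma collapse_norm (E : nat) :
  (forall y, @Y 0 y -> (`|@eps 0 y| <= E)%N) ->
  forall j b, @B j b -> (l1_norm (@collapsed_basis j) (collapse j b) <= E.+1)%N.
Proof.
move=> hE j b Bb; rewrite collapseE // /collapse_fun.
have gen_norm k : (l1_norm (@collapsed_basis j) (cell_gen k) <= 1)%N.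
  rewrite /cell_gen; case: insubP => [k' _ _|_].
    by apply: l1_norm_basis; [exact: collapsed_basisP|exists k'].
  by rewrite l1_norm0 //; exact: collapsed_basisP.
case: asboolP => Yb; last exact: leq_trans (gen_norm _) _.
apply: leq_trans (l1_normZ (@collapsed_basisP _) _ _) _.
case: j b Bb gen_norm Yb => [|j] b Bb gen_norm Yb.
  by apply: (leq_trans (leq_mul (hE b Yb) (gen_norm _))); rewrite muln1.
by rewrite /cell_gen insubF // l1_norm0 ?muln0 //; exact: collapsed_basisP.
Qed.

(** The new boundary of a remaining cell is the collapse of its old boundary, of norm at most
    (E+1)D. With D+1 in place of D, the same constant also bounds the projection when D = 0. *)
Lemma collapse_rebuilding (R : realType) (n E D : nat) (T kappa : R) :
  (forall j, (j <= n)%N -> finite_set (@B j)) ->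
  (forall j, (j <= n)%N -> exists Z : {fset X j}, @B j `\` @Y j `<=` [set` Z] /\
     (#|` Z| + (j == 0))%:R <= kappa * T^-1 * (rank (@B j))%:R) ->
  (forall y, @Y 0 y -> (`|@eps 0 y| <= E)%N) ->
  (forall j, (j < n)%N -> forall b, @B j.+1 b -> (l1_norm (@B j) (bd X j b) <= D)%N) ->
  (E.+1 * D.+1)%:R <= expR kappa * T `^ kappa ->
  admits_weak_rebuilding n T kappa B.
Proof.
move=> fB hZ hE hD hc.
have bB' := collapsed_basisP.
have E1 : (E.+1)%:R <= expR kappa * T `^ kappa.
  by apply: le_trans hc; rewrite ler_nat mulnS leq_addr.
exists collapsed, collapsed_basis, collapse_retract; split=> //.
- move=> j jn; split; first exact: finite_basis_generates (fB j jn) (@bB j).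
  have [Z [sZ _]] := hZ j jn.
  exact: finite_basis_generates (proj1 (finite_cells sZ)) (bB' j).
- move=> j jn; have [Z [sZ le]] := hZ j jn; apply: le_trans le.
  by rewrite ler_nat; exact: (proj2 (finite_cells sZ)).
- move=> j jn; apply: operator_norm_le (bB' _) (bB' _) _ hc.
  move=> _ [[[b|] h] _ <-]; rewrite [bd _ _ _]collapsed_bdU /collapsed_bd_fun /=; last by rewrite l1_norm0.
  have /asboolP[Bb _] := h.
  apply: leq_trans (l1_norm_linear (@bB j) (bB' j) (collapse_norm hE (j := j)) _) _.
  by apply: leq_mul => //; apply: leqW; exact: hD.
- by move=> j _; exact: operator_norm_le (@bB _) (bB' _) (collapse_norm hE (j := j)) E1.
Qed.

End Collapse.

(** * Modules over the group ring *)

Section GroupRingModules.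
Context (G : groupType) (M : lmodType (group_ring G)) (B : set M).
Local Notation ZG := (group_ring G).

Definition translate (g : G) (x : M) : M := (<< g >> : ZG) *: x.

Lemma translateM g h x : translate g (translate h x) = translate (g * h)%g x.
Proof. by rewrite /translate scalerA; congr (_ *: _); exact: gr_mulUU. Qed.

Lemma monalgU_mulz (g : G) (a : int) : << a *g g >> = << g >> *~ a :> ZG.
Proof.
by rewrite -(raddfMz (mkmalgU g)) intz.
Qed.

Lemma scale_translate (r : ZG) (x : M) :
  r *: x = \sum_(g <- msupp r) translate g x *~ r@_g.
Proof.
rewrite [r in LHS]monalgE scaler_suml; apply: eq_bigr => g _.
by rewrite monalgU_mulz -scalerMzl.
Qed.

Lemma additive_ind (V : zmodType) (P : V -> Prop) :
  P 0 -> (forall x y, P x -> P y -> P (x - y)) ->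
  forall I (s : seq I) (v : I -> V) (a : I -> int), (forall i, P (v i)) ->
  P (\sum_(i <- s) v i *~ a i).
Proof.
move=> P0 PB I s v a Pv.
have PN x : P x -> P (- x) by move=> Px; rewrite -sub0r; exact: PB.
have PD x y : P x -> P y -> P (x + y).
  by move=> Px Py; rewrite -[y]opprK; apply: PB => //; exact: PN.
have Pn x (n : nat) : P x -> P (x *+ n).
  by move=> Px; elim: n => [|n IHn]; rewrite ?mulr0n // mulrS; exact: PD.
apply: big_ind => // i _; case: (a i) => n; first exact: Pn.
by rewrite NegzE mulrNz; apply: PN; exact: Pn.
Qed.

Lemma translates_ind (P : M -> Prop) : generates B ->
  P 0 -> (forall x y, P x -> P y -> P (x - y)) ->
  (forall g b, B b -> P (translate g b)) -> forall x, P x.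
Proof.
move=> /generatesP ind P0 PB Pt.
suff h x : forall r, P (r *: x) by move=> x; rewrite -[x]scale1r; exact: h.
move: x; apply: ind.
- by move=> r; rewrite scaler0.
- move=> a x y hx hy r; rewrite scalerDr scalerA -[r *: y]opprK.
  by apply: (PB) => //; rewrite -sub0r; exact: PB.
- by move=> b Bb r; rewrite scale_translate; apply: additive_ind => // g; exact: Pt.
Qed.

Lemma eq_on_translates (V : zmodType) (f g : {additive M -> V}) : generates B ->
  (forall h b, B b -> f (translate h b) = g (translate h b)) -> f =1 g.
Proof.
move=> gB fg; apply: translates_ind => //; first by rewrite !raddf0.
by move=> x y fx fy; rewrite !raddfB fx fy.
Qed.

Section Extension.
Context (V : zmodType) (psi : G -> M -> V) (bB : is_basis B).

Definition translates_extend_fun (x : M) : V :=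
  \sum_(b <- msupp (coordinates B x)) free_lift (psi^~ b) (coordinates B x)@_b.

Lemma free_lift0 b : free_lift (psi^~ b) 0 = 0.
Proof. by rewrite /free_lift msupp0 big_seq_fset0. Qed.

Lemma translates_extendw (d : {fset M}) x :
  (msupp (coordinates B x) `<=` d)%fset ->
  translates_extend_fun x = \sum_(b <- d) free_lift (psi^~ b) (coordinates B x)@_b.
Proof.
move=> le; rewrite /translates_extend_fun (big_fset_incl _ le) //.
by move=> b _ /mcoeff_outdom ->; exact: free_lift0.
Qed.

Fact translates_extend_additive : zmod_morphism translates_extend_fun.
Proof.
move=> x y; pose d := (msupp (coordinates B x) `|` msupp (coordinates B y))%fset.
have e : coordinates B (x - y) = coordinates B x - coordinates B y.
  exact: (linearB (pack_linear (coordinates_linear bB))).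
rewrite (@translates_extendw d x) ?fsubsetUl // (@translates_extendw d y) ?fsubsetUr //.
rewrite (@translates_extendw d) ?e ?msuppB_le // -sumrB.
by apply: eq_bigr => b _; rewrite mcoeffB free_liftB.
Qed.

Definition pack_additive (U W : zmodType) (f : U -> W) (zf : zmod_morphism f) :
  {additive U -> W} := HB.pack f (GRing.isZmodMorphism.Build U W f zf).

(** The translates of a [ZG]-basis form a [Z]-basis. The extension is only additive, as it must be
    for the contraction and for maps defined through a transversal. *)
Lemma translates_extend : exists f : {additive M -> V},
  forall g b, B b -> f (translate g b) = psi g b.
Proof.
exists (pack_additive translates_extend_additive) => g b Bb.
have e : coordinates B (translate g b) = (<< g >> : ZG) *: << b >>.
  rewrite -[LHS]/(pack_linear (coordinates_linear bB) _) linearZ /=.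
  by rewrite (coordinatesE bB (expandsU Bb)).
rewrite /= (@translates_extendw [fset b]%fset) e; last first.
  by apply: fsubset_trans (msuppZ_le _ _) _; exact: msuppU_le.
by rewrite big_seq_fset1 mcoeffZ mcoeffUU mulr1 free_liftU.
Qed.

End Extension.

End GroupRingModules.

(** * Contraction of the resolution as a complex of abelian groups *)

Section Contraction.
Context (G : groupType) (X : chain_complex (group_ring G)).
Context (eta : {linear X 0%N -> trivial_module G}) (B : forall j, set (X j)).
Hypothesis rX : projective_resolution eta.
Hypothesis bB : based_free B.

Lemma lift_through_bd j (f : {additive X j -> X j}) :
  (forall x, exists y, bd X j y = f x) ->
  exists s : {additive X j -> X j.+1}, forall x, bd X j (s x) = f x.
Proof.
move=> /choice[h hP].
have [s sP] := translates_extend (fun g b => h (translate g b)) (@bB j).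
exists s; apply: (eq_on_translates (f := bd X j \o s) (basis_generates (@bB j))).
by move=> g b Bb; rewrite /= sP.
Qed.

Lemma eta_mulz_additive (w : X 0%N) : zmod_morphism (fun x : X 0%N => w *~ (eta x : int)).
Proof. by move=> y z; rewrite raddfB mulrzBr. Qed.

Lemma contraction : exists (w : X 0%N) (s : forall j, {additive X j -> X j.+1}),
  (forall x, bd X 0 (s 0%N x) = x - w *~ (eta x : int)) /\
  (forall j x, bd X j.+1 (s j.+1 x) = x - s j (bd X j x)).
Proof.
have [_ eta_surj eta_ker ex] := rX.
have [w w1] := eta_surj (1 : int); exists w.
have etaz x (a : int) : eta (x *~ a) = (eta x : int) * a :> int.
  by rewrite raddfMz -mulrzr intz.
have [s0 s0P] : exists s : {additive X 0%N -> X 1%N},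
    forall x, bd X 0 (s x) = x - w *~ (eta x : int).
  apply: (@lift_through_bd 0 (idfun \- pack_additive (eta_mulz_additive w))) => x.
  by apply/eta_ker; rewrite raddfB /= etaz w1 mul1r subrr.
(* Invariant of the recursion: it makes [x - s (bd x)] a cycle, hence by exactness a boundary, so
   that the next map is obtained by lifting through the differential. *)
pose inv j (s : {additive X j -> X j.+1}) :=
  forall x, bd X j (s (bd X j x)) = bd X j x.
have inv0 : inv 0%N s0.
  move=> x; rewrite s0P (_ : eta _ = 0) ?mulr0z ?subr0 //.
  by apply/eta_ker; exists x.
have step j (s : {s : {additive X j -> X j.+1} | inv j s}) :
    exists s' : {additive X j.+1 -> X j.+2},
      forall x, bd X j.+1 (s' x) = x - sval s (bd X j x).
  apply: (@lift_through_bd j.+1 (idfun \- (sval s \o bd X j))) => x.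
  by apply/ex; rewrite /= raddfB /= (svalP s) subrr.
have inv_step j s : inv j.+1 (sval (cid (@step j s))).
  by move=> x; rewrite (svalP (cid (step j s))) bd_bd raddf0 subr0.
pose s := fix s j : {s : {additive X j -> X j.+1} | inv j s} :=
  match j with
  | 0 => exist _ s0 inv0
  | j'.+1 => exist _ (sval (cid (@step j' (s j')))) (@inv_step j' (s j'))
  end.
exists (fun j => sval (s j)); split; first exact: s0P.
move=> j x; exact: (svalP (cid (@step j (s j)))).
Qed.

End Contraction.

(** * Bases of the quotient complexes *)

Section TensorBasis.
Context (G : groupType) (L : set G) (M : lmodType (group_ring G)) (B : set M).
Hypotheses (sL : subgroup L) (bB : is_basis B).
Local Notation ZG := (group_ring G).
Local Notation tensorZ := (zmodule (tensor L M)).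

Definition tens1 (x : M) : tensorZ := tens L 1 x.

Fact tens1_is_additive : zmod_morphism tens1.
Proof.
have [_ tD _] := tens_balanced L M.
have t0 : tens L 1 (0 : M) = 0.
  by apply: (addrI (tens L 1 (0 : M))); rewrite -tD !addr0.
have tN y : tens L 1 (- y : M) = - tens L 1 y.
  by apply/eqP; rewrite -addr_eq0 -tD addNr t0.
by move=> x y; rewrite /tens1 tD tN.
Qed.

HB.instance Definition _ := GRing.isZmodMorphism.Build M tensorZ tens1 tens1_is_additive.

Lemma tensE a x : tens L a x = tens1 x *~ a.
Proof.
have [tD _ _] := tens_balanced L M.
have zt : zmod_morphism (fun a : int => tens L a x).
  move=> b c; apply/eqP; rewrite eq_sym subr_eq -tD subrK.
  exact: eqxx.
have := raddfMz (pack_additive zt) a (1 : int).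
by rewrite /= intz.
Qed.

Lemma tens1_invariant l x : L l -> tens1 (translate l x) = tens1 x.
Proof.
move=> Ll; have [_ _ /(_ 1 << l >> x) tL] := tens_balanced L M.
rewrite /tens1 -[LHS]tL ?augmentationU ?mulr1 //.
by move=> g /= /(fsubsetP msuppU_le); rewrite inE => /eqP ->.
Qed.

Definition tensor_basis : set tensorZ :=
  [set t | exists g b, B b /\ t = tens1 (translate g b)].

Lemma tensor_generates : generates tensor_basis.
Proof.
apply/generatesP => P P0 PD PB.
have PN s : P s -> P (- s) by move=> Ps; rewrite -scaleN1r -[X in P X]addr0; exact: PD.
have PB' s t : P s -> P t -> P (s - t).
  by move=> Ps Pt; rewrite -[s]scale1r; apply: PD => //; exact: PN.
have P1 x : P (tens1 x).
  move: x; apply: (translates_ind (basis_generates bB)).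
  - by rewrite raddf0.
  - by move=> x y Px Py; rewrite raddfB; exact: PB'.
  - by move=> g b Bb; apply: PB; exists g, b.
elim/tensor_ind => // a x; rewrite tensE -[_ *~ _]addr0 -scaler_int intz.
exact: PD.
Qed.

(** The additive extension [F] of [psi] satisfies F(r x) = augmentation(r) F(x) for [r] supported in
    [L], as is checked on translates; hence the map sending (a, x) to a F(x) is balanced. *)
Lemma tensor_extend (V : lmodType int) (psi : G -> M -> V) :
  (forall l g b, L l -> psi (l * g)%g b = psi g b) ->
  exists f : {linear tensorZ -> V},
    forall g b, B b -> f (tens1 (translate g b)) = psi g b.
Proof.
move=> psiL; have [F FP] := translates_extend psi bB.
have Fr r x : supported_in L r -> F (r *: x) = F x *~ augmentation r.
  move=> Lr.
  have zr : zmod_morphism (fun x : M => r *: x) by move=> y z; rewrite scalerBr.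
  have zf : zmod_morphism (fun x : M => F x *~ augmentation r).
    by move=> y z; rewrite raddfB mulrzBl.
  apply: (eq_on_translates (f := F \o pack_additive zr) (g := pack_additive zf)
    (basis_generates bB)) => g b Bb /=.
  rewrite scale_translate raddf_sum /augmentation mulrz_sumr.
  rewrite big_seq [RHS]big_seq; apply: eq_bigr => l /Lr Ll.
  by rewrite raddfMz translateM !FP // psiL.
have bal : balanced L (fun a x => F x *~ a).
  split=> [a b x|a x y|a r x Lr]; first exact: mulrzDr.
    by rewrite raddfD mulrzDl.
  by rewrite Fr // -mulrzA mulrC.
have zf : zmod_morphism (tensor_lift (fun a x => F x *~ a) : tensorZ -> V).
  exact: (tensor_liftB bal).
have lf : linear (tensor_lift (fun a x => F x *~ a) : tensorZ -> V).
  move=> a s t; rewrite [LHS](raddfD (pack_additive zf)); congr (_ + _).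
  by rewrite -[a]intz !scaler_int; exact: (raddfMz (pack_additive zf)).
exists (pack_linear lf) => g b Bb /=.
by rewrite (tensor_lift_tens bal) FP.
Qed.

(** The functional dual to [t0] is induced by the indicator of [tens1 (translate g b) == t0], which
    is constant along cosets [L g]; this way independence does not require knowing when two cells
    coincide. *)
Lemma tensor_is_basis : is_basis tensor_basis.
Proof.
apply: basis_of_functionals tensor_generates _ => t0 _.
have [|f fP] := @tensor_extend int^o (fun g b => (tens1 (translate g b) == t0)%:R).
  by move=> l g b Ll; rewrite -translateM tens1_invariant.
by exists f => _ [g [b [Bb ->]]]; exact: fP.
Qed.

Lemma tensor_basis_inj g b h c : B b -> B c ->
  tens1 (translate g b) = tens1 (translate h c) -> L (g * h^-1)%g /\ b = c.
Proof.
move=> Bb Bc e.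
pose psi g' b' : int^o := (`[< L (g' * h^-1)%g >] && (b' == c))%:R.
have [|f fP] := @tensor_extend int^o psi.
  move=> l k b' Ll; rewrite /psi; congr ((_ && _)%:R); apply: asbool_equiv_eq.
  rewrite -mulgA; split=> h1; last exact: subgroupM.
  by rewrite -[X in L X](mulKg l); apply: subgroupM => //; exact: subgroupV.
have := congr1 f e; rewrite !fP // /psi eqxx mulgV.
rewrite (_ : `[< L 1%g >]); last by apply/asboolP; exact: (proj1 sL).
by case: asboolP => // h1; case: eqP.
Qed.

End TensorBasis.

(** * Rebuilding from a transversal *)

Lemma card_fsetM (K K' : choiceType) (A : {fset K}) (C : {fset K'}) :
  #|` (A `*` C)%fset| = (#|` A| * #|` C|)%N.
Proof.
rewrite -(size_allpairs pair); apply/perm_size/uniq_perm.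
- exact: fset_uniq.
- by apply: allpairs_uniq; rewrite ?fset_uniq // => -[? ?] [? ?] _ _ /= [-> ->].
move=> [x y]; rewrite in_fsetM; apply/andP/allpairsP => /=.
  by case=> xA yC; exists (x, y).
by case=> -[x' y'] /= [xA yC [-> ->]].
Qed.

Section BoundarySupport.
Context (G : groupType) (X : chain_complex (group_ring G)) (B : forall j, set (X j)).
Hypothesis bB : based_free B.

(** The faces of the cell [g.b] are cells [(g h).b'] with [h] in this set. *)
Definition bd_support j (b : X j.+1) : {fset G} :=
  (\bigcup_(b' <- msupp (coordinates (@B j) (bd X j b)))
     msupp (coordinates (@B j) (bd X j b))@_b')%fset.

Definition bd_weight j (b : X j.+1) : nat :=
  (\sum_(b' <- msupp (coordinates (@B j) (bd X j b)))
     \sum_(h <- msupp (coordinates (@B j) (bd X j b))@_b')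
       `|(coordinates (@B j) (bd X j b))@_b'@_h|)%N.

Lemma bd_translate j g (b : X j.+1) :
  bd X j (translate g b) =
  \sum_(b' <- msupp (coordinates (@B j) (bd X j b)))
     \sum_(h <- msupp (coordinates (@B j) (bd X j b))@_b')
       translate (g * h)%g b' *~ (coordinates (@B j) (bd X j b))@_b'@_h.
Proof.
have [_ e] := coordinatesP (bd X j b) (@bB j).
rewrite /translate linearZ /= -[in LHS]e /lincomb scaler_sumr; apply: eq_bigr => b' _.
rewrite (scale_translate _ b') scaler_sumr; apply: eq_bigr => h _.
rewrite -scalerMzr; congr (_ *~ _); exact: translateM.
Qed.

Lemma eq_on_boundary j (V : zmodType) (f f' : {additive X j -> V}) g (b : X j.+1) :
  (forall h b', h \in bd_support b -> B b' ->
     f (translate (g * h)%g b') = f' (translate (g * h)%g b')) ->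
  f (bd X j (translate g b)) = f' (bd X j (translate g b)).
Proof.
move=> ff'; have [sc _] := coordinatesP (bd X j b) (@bB j).
rewrite bd_translate !raddf_sum big_seq [RHS]big_seq; apply: eq_bigr => b' b's.
rewrite !raddf_sum big_seq [RHS]big_seq; apply: eq_bigr => h hs.
rewrite !raddfMz ff' //; last exact: sc.
by apply/bigfcupP; exists b'; rewrite ?andbT.
Qed.

(** Passing to the quotient can only merge faces, so the coefficient sum taken in [X] is a bound
    uniform in [L] and [g]. *)
Lemma bd_weight_norm (L : set G) j (g : G) (b : X j.+1) :
  (l1_norm (induced_basis L B j)
     (bd (induced_complex X L) j (tens1 L (translate g b))) <= bd_weight b)%N.
Proof.
have bT := tensor_is_basis (L := L) (@bB j).
have [sc _] := coordinatesP (bd X j b) (@bB j).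
have -> : bd (induced_complex X L) j (tens1 L (translate g b)) =
  tens1 L (bd X j (translate g b)) by exact: tensor_map_tens.
rewrite bd_translate raddf_sum; apply: leq_trans (l1_norm_sum bT _ _) _.
rewrite /bd_weight big_seq [leqRHS]big_seq; apply: leq_sum => b' /sc Bb'.
rewrite raddf_sum; apply: leq_trans (l1_norm_sum bT _ _) _.
apply: leq_sum => h _; rewrite raddfMz -scaler_int intz.
apply: leq_trans (l1_normZ bT _ _) _; rewrite -[leqRHS]muln1 leq_mul //.
by apply: l1_norm_basis => //; exists (g * h)%g, b'.
Qed.

End BoundarySupport.

Section Transversal.
Context (R : realType) (G : groupType) (X : chain_complex (group_ring G)).
Context (eta : {linear X 0%N -> trivial_module G}) (B : forall j, set (X j)).
Hypotheses (rX : projective_resolution eta) (bB : based_free B).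
Context (n : nat) (S : nat -> {fset G}).
Hypothesis fB : forall j, (j <= n)%N -> finite_set (@B j).
Hypothesis S1 : forall j, 1%g \in S j.
Hypothesis S_bd : forall j (b : X j.+1) h s, (j < n)%N -> B b ->
  h \in bd_support B b -> s \in S j -> (h * s)%g \in S j.+1.
Context (L : set G) (sL : subgroup L) (D : {fset G}).
Hypothesis D_meets : forall g, exists2 d, d \in D & L (d * g^-1)%g.
Hypothesis D_inj : forall d d', d \in D -> d' \in D -> L (d * d'^-1)%g -> d = d'.
Local Notation XL := (induced_complex X L).
Local Notation BL := (induced_basis L B).
Local Notation proj := (@tens1 G L _).

Let lift (g : G) : G := sval (cid2 (D_meets g)).

Lemma lift_in g : lift g \in D.
Proof. exact: (s2valP (cid2 (D_meets g))). Qed.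

Lemma lift_coset g : L (lift g * g^-1)%g.
Proof. exact: (s2valP' (cid2 (D_meets g))). Qed.

Lemma liftMl l g : L l -> lift (l * g)%g = lift g.
Proof.
move=> Ll; apply: D_inj; rewrite ?lift_in //.
have -> : (lift (l * g) * (lift g)^-1 =
    (lift (l * g) * (l * g)^-1) * l * (lift g * g^-1)^-1)%g.
  by rewrite !invgM invgK !mulgA !mulgVK.
have := subgroupV sL (lift_coset g); have := lift_coset (l * g)%g.
by move=> h1 h2; apply: subgroupM => //; exact: subgroupM.
Qed.

Lemma lift_id d : d \in D -> lift d = d.
Proof. by move=> dD; apply: D_inj => //; [exact: lift_in|exact: lift_coset]. Qed.

Lemma proj_lift j g (b : X j) : proj (translate (lift g) b) = proj (translate g b).
Proof.
rewrite -[X in translate (lift X) b]mulg1 -[lift _](mulgVK g) mulg1.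
by rewrite -translateM tens1_invariant //; exact: lift_coset.
Qed.

Definition interior j (x : G) := x \in D /\ forall s, s \in S j -> (x * s)%g \in D.

(** Nothing is collapsed above degree [n], where neither the window condition nor finiteness of the
    bases is available. *)
Definition interior_cells j : set (XL j) :=
  [set t | (j <= n)%N /\
    exists x b, [/\ @B j b, interior j x & t = proj (translate x b)]].

(** This is the purpose of the windows: the interior cells span a subcomplex. *)
Lemma interior_bd j (b : X j.+1) x h : (j < n)%N -> B b -> interior j.+1 x ->
  h \in bd_support B b -> interior j (x * h)%g.
Proof.
move=> jn Bb [xD xS] hb; split.
  by apply: xS; rewrite -[h]mulg1; exact: S_bd jn Bb hb (S1 j).
by move=> s sS; rewrite -mulgA; apply: xS; exact: S_bd jn Bb hb sS.
Qed.

Lemma induced_basisP : based_free BL.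
Proof. by move=> j; exact: tensor_is_basis (@bB j). Qed.

Lemma induced_cells j : (j <= n)%N ->
  BL j = [set` [fset proj (translate p.1 p.2) | p in (D `*` fset_set (@B j))%fset]%fset].
Proof.
move=> jn; apply/seteqP; split=> [t [g [b [Bb ->]]]|t /= /imfsetP[[g b] /=]].
  rewrite -[X in _ X](proj_lift g b); apply/imfsetP; exists (lift g, b) => //=.
  by rewrite in_fsetM /= lift_in in_fset_set ?inE //; exact: fB.
rewrite in_fsetM /= in_fset_set ?inE; last exact: fB.
by move=> /andP[_ /set_mem Bb] ->; exists g, b.
Qed.

Lemma finite_induced_basis j : (j <= n)%N -> finite_set (BL j).
Proof. by move=> jn; rewrite induced_cells //; exact: finite_fset. Qed.

Lemma rank_induced_basis j : (j <= n)%N ->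
  rank (BL j) = (#|` D| * #|` fset_set (@B j)|)%N.
Proof.
move=> jn; rewrite /rank induced_cells // set_fsetK card_in_imfset /=.
  exact: card_fsetM.
move=> [g b] [h c]; rewrite !inE /= => /andP[gD bB'] /andP[hD cB'] e.
have inB (b' : X j) : b' \in fset_set (@B j) -> B b'.
  by rewrite in_fset_set; [exact: set_mem|exact: fB].
have [Lgh ->] := tensor_basis_inj sL (@bB j) (inB _ bB') (inB _ cB') e.
by rewrite (D_inj gD hD Lgh).
Qed.

Definition boundary_cells j (bad : {fset G}) : {fset XL j} :=
  [fset proj (translate p.1 p.2) | p in (bad `*` fset_set (@B j))%fset]%fset.

Lemma boundary_cellsP j (bad : {fset G}) : (j <= n)%N ->
  (forall x, x \in D -> ~ interior j x -> x \in bad) ->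
  BL j `\` @interior_cells j `<=` [set` boundary_cells j bad] /\
  (#|` boundary_cells j bad| <= #|` bad| * #|` fset_set (@B j)|)%N.
Proof.
move=> jn hbad; split; last first.
  by apply: leq_trans (leq_imfset_card _ _ _) _; rewrite /= card_fsetM.
move=> t [[g [b [Bb ->]]] nY] /=; apply/imfsetP; exists (lift g, b) => /=.
  rewrite in_fsetM /= in_fset_set ?mem_set ?andbT //; last exact: fB.
  apply: hbad (lift_in g) _ => intg; apply: nY; split=> //.
  by exists (lift g), b; split=> //; exact: esym (proj_lift g b).
exact: esym (proj_lift g b).
Qed.

Lemma eta_translate g (b : X 0%N) : eta (translate g b) = eta b.
Proof.
rewrite /translate linearZ.
rewrite -[LHS]/(augmentation (<< g >> : group_ring G) * (eta b : int)).
by rewrite augmentationU mul1r.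
Qed.

Lemma augmentation_lift : exists e : {linear XL 0%N -> int^o},
  forall x, e (proj x) = eta x.
Proof.
have [|e eP] := @tensor_extend G L (X 0%N) (@B 0%N) (@bB 0%N) int^o
  (fun g b => eta (translate g b)).
  by move=> l g b _; rewrite !eta_translate.
have z_eta : zmod_morphism (fun x => eta x : int^o) by move=> x y; exact: raddfB.
exists e => x. apply: (eq_on_translates (f := e \o proj) (g := pack_additive z_eta)
  (basis_generates (@bB 0%N))) => g b Bb; exact: eP.
Qed.

(** Lift a cell to [D], contract in [X] and project back; well defined because the lift depends only
    on the coset. The formula is used on all cells; outside the interior its failure to follow the
    differential is absorbed by [deviation]. *)
Lemma htpy_lift j (s : {additive X j -> X j.+1}) :
  exists f : {linear XL j -> XL j.+1},
    forall g b, B b -> f (proj (translate g b)) = proj (s (translate (lift g) b)).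
Proof.
apply: (@tensor_extend G L (X j) (@B j) (@bB j) (XL j.+1)
  (fun g b => proj (s (translate (lift g) b)))) => l g b Ll.
by rewrite liftMl.
Qed.

Lemma transversal_rebuilding (E C : nat) (bad : {fset G}) (T kappa : R) :
  (forall j x, (j <= n)%N -> x \in D -> ~ interior j x -> x \in bad) ->
  (forall b : X 0%N, B b -> (`|(eta b : int)| <= E)%N) ->
  (forall j (b : X j.+1), (j < n)%N -> B b -> (bd_weight B b <= C)%N) ->
  (forall j, (j <= n)%N ->
     (#|` bad| * #|` fset_set (@B j)| + (j == 0))%:R
       <= kappa * T^-1 * (#|` D| * #|` fset_set (@B j)|)%:R) ->
  (E.+1 * C.+1)%:R <= expR kappa * T `^ kappa ->
  admits_weak_rebuilding n T kappa BL.
Proof.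
move=> hbad hE hC hrank hk.
have [w [s [s0 sS]]] := contraction rX bB.
have [e eP] := augmentation_lift.
pose Xi j : {linear XL j -> XL j.+1} := sval (cid (htpy_lift (s j))).
have XiP j g (b : X j) : B b ->
  Xi j (proj (translate g b)) = proj (s j (translate (lift g) b)).
  exact: (svalP (cid (htpy_lift (s j)))).
pose eps j : {linear XL j -> int^o} := if j is 0 then e else \0.
pose eps' j (t : XL j) : int := eps j t.
(* The extra generator stands for the base point [w]; in positive degrees the value 0 is a
   placeholder. *)
pose u j : XL j := if j is 0 then proj w else 0.
have bdP j x : bd XL j (proj x) = proj (bd X j x) by exact: tensor_map_tens.
have eta_bd x : eta (bd X 0 x) = 0.
  by have [_ _ ek _] := rX; apply/ek; exists x.
have eps_bd j x : eps j (proj (bd X j x)) = 0.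
  by case: j x => [|j] x //=; rewrite eP eta_bd.
(* All faces of an interior cell are based in [D], where the lift is the identity, so [Xi] agrees
   with [s] on its boundary. *)
have Xi_bd j x (b : X j.+1) : (j < n)%N -> B b -> interior j.+1 x ->
    Xi j (proj (bd X j (translate x b))) = proj (s j (bd X j (translate x b))).
  move=> jn Bb ix; apply: (eq_on_boundary bB (f := Xi j \o proj) (f' := proj \o s j)).
  move=> h b' hb Bb' /=; rewrite XiP // lift_id //.
  exact: (proj1 (interior_bd jn Bb ix hb)).
have collapse_interior j x (b : X j) : (j <= n)%N -> B b -> interior j x ->
    collapse induced_basisP interior_cells eps' j (proj (translate x b)) =
    eps j (proj (translate x b)) *: cell_gen BL interior_cells (None : option (XL j)).
  move=> jn Bb ix; rewrite collapseE; last by exists x, b.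
  by rewrite /collapse_fun asboolT //; split=> //; exists x, b.
have dev0 t : deviation Xi 0 t = t - bd XL 0 (Xi 0%N t) by [].
have devS j t : deviation Xi j.+1 t =
  t - (bd XL j.+1 (Xi j.+1 t) + Xi j (bd XL j t)) by [].
apply: (@collapse_rebuilding XL BL induced_basisP interior_cells Xi eps' u
  _ _ _ R n E C T kappa) => //.
(* The boundary of an interior cell consists of interior cells, so it collapses to its augmentation
   times the extra generator, and the augmentation of a boundary is 0. *)
- move=> j _ [jn [x [b [Bb ix ->]]]]; rewrite bdP.
  have za : zmod_morphism (fun y : X j => collapse induced_basisP interior_cells eps' j (proj y)).
    by move=> y z; rewrite !raddfB.
  have zb : zmod_morphism (fun y : X j =>
      eps j (proj y) *: cell_gen BL interior_cells (None : option (XL j))).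
    by move=> y z; rewrite !raddfB scalerBl.
  have := eq_on_boundary bB (f := pack_additive za) (f' := pack_additive zb) (g := x) (b := b).
  move=> /= ->; first by rewrite eps_bd scale0r.
  by move=> h b' hb Bb'; apply: collapse_interior (ltnW jn) Bb' (interior_bd jn Bb ix hb).
- move=> _ [jn [x [b [Bb ix ->]]]].
  rewrite dev0 XiP // (lift_id (proj1 ix)) bdP s0 raddfB opprB.
  by rewrite addrC subrK raddfMz /eps' /= eP -scaler_int intz.
- move=> j _ [jn [x [b [Bb ix ->]]]].
  rewrite devS XiP // (lift_id (proj1 ix)) !bdP Xi_bd // sS raddfB.
  by rewrite subrK subrr.
- exact: finite_induced_basis.
- move=> j jn; have [sub le] := boundary_cellsP jn (hbad j ^~ jn).
  exists (boundary_cells j bad); split=> //; rewrite rank_induced_basis //.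
  by apply: le_trans (hrank j jn); rewrite ler_nat leq_add2r.
- by move=> _ [_ [x [b [Bb _ ->]]]]; rewrite /eps' /= eP eta_translate; exact: hE.
- move=> j jn _ [g [b [Bb ->]]].
  exact: leq_trans (bd_weight_norm bB L g b) (hC j b jn Bb).
Qed.

End Transversal.

(** * Choice of the windows and of the constants *)

Section InteriorWindows.
Context (G : groupType) (X : chain_complex (group_ring G)) (B : forall j, set (X j)).
Context (n : nat).
Hypothesis fB : forall j, (j <= n)%N -> finite_set (@B j).

Definition bd_window : {fset G} :=
  (\bigcup_(j <- iota 0 n) \bigcup_(b <- fset_set (@B j.+1)) bd_support B b)%fset.

(** The products of at most [j] elements of [bd_window], which leave room for [j] successive
    boundaries. *)
Fixpoint window (j : nat) : {fset G} :=
  (if j is j'.+1 then 1%g |` [fset (h * s)%g | h in bd_window, s in window j'] else [fset 1%g])%fset.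

Lemma window1 j : 1%g \in window j.
Proof. by case: j => [|j] /=; rewrite !inE // eqxx. Qed.

Lemma window_bd j (b : X j.+1) h s : (j < n)%N -> B b ->
  h \in bd_support B b -> s \in window j -> (h * s)%g \in window j.+1.
Proof.
move=> jn Bb hb sW /=; rewrite in_fset1U; apply/orP; right; apply: in_imfset2 => //=.
apply/bigfcupP; exists j; first by rewrite mem_iota /= jn.
by apply/bigfcupP; exists b; rewrite ?andbT // in_fset_set ?mem_set //; exact: fB.
Qed.

End InteriorWindows.

Lemma leq_sum_fset (K : choiceType) (A : {fset K}) (f : K -> nat) x :
  x \in A -> (f x <= \sum_(y <- A) f y)%N.
Proof. by move=> xA; rewrite (big_fsetD1 x xA) leq_addr. Qed.

Lemma powR_exp_ge (R : realType) (T kappa : R) :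
  1 <= T -> 0 <= kappa -> kappa <= expR kappa * T `^ kappa.
Proof.
move=> T1 k0; apply: (@le_trans _ _ (expR kappa)).
  by apply: le_trans (expR_ge1Dx kappa); rewrite ler_wpDl.
by rewrite ler_peMr ?expR_ge0 // -(powRr0 T) ler_powR.
Qed.

Theorem theorem5p23 (R : realType) (n : nat) (G : groupType) :
  residually_finite G -> infinite_set [set: G] -> amenable R G -> FP n G ->
  CWR R n G.
Proof.
move=> rfG infG amG /based_resolution[X [eta [B [rX bB fB]]]].
split=> //; exists X, eta, B; split=> //; split=> // [j jn|].
  exact: finite_basis_generates (fB j jn) (bB j).
pose E := (\sum_(b <- fset_set (B 0%N)) `|(eta b : int)|)%N.
pose C := (\sum_(j < n) \sum_(b <- fset_set (B j.+1)) bd_weight B b)%N.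
(* The norm bound itself serves as [kappa], since kappa <= exp(kappa) <= exp(kappa) T^kappa. *)
pose kappa : R := (E.+1 * C.+1)%:R.
have kappa1 : 1 <= kappa by rewrite /kappa ler1n muln_gt0.
exists kappa; split=> // T T1 L rL.
have T0 : 0 < T by apply: lt_le_trans T1.
pose e := (2 * T)^-1; have e0 : 0 < e by rewrite invr_gt0 mulr_gt0.
pose W := (\bigcup_(j <- iota 0 n.+1) window B n j)%fset.
have [i0 Hi] := folner_transversal amG infG rL W (Num.bound (2 * T)) e0.
exists i0 => i le; have [D [D_meets D_inj D_big D_bad]] := Hi i le.
have [_ _ /(_ i)[[sL _] _] _] := rL.
have inB j b : (j <= n)%N -> B j b -> b \in fset_set (B j).
  by move=> jn Bb; rewrite in_fset_set ?mem_set //; exact: fB.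
(* [B 0] is nonempty because [eta] is onto the integers; hence the extra generator can be charged to
   the rank in degree 0. *)
have k0 : (0 < #|` fset_set (B 0%N)|)%N.
  rewrite cardfs_gt0; apply/fset0Pn; apply: contrapT => nB.
  have X0 : forall x : X 0%N, x = 0.
    have /generatesP ind := basis_generates (bB 0%N); apply: ind => //.
      by move=> a x y -> ->; rewrite scaler0 addr0.
    by move=> b Bb; case: nB; exists b; exact: inB.
  have [_ eta_surj _ _] := rX; have [x] := eta_surj (1 : int).
  by rewrite (X0 x) linear0.
apply: (transversal_rebuilding rX bB fB (@window1 _ _ B n) (window_bd fB) sL D_meets D_inj
  (E := E) (C := C) (bad := [fset x in D | ~~ all (fun s => (x * s)%g \in D) W]%fset)).
- move=> j x jn xD nint; rewrite !inE xD; apply/negP => /allP h; apply: nint; split=> // s sW.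
  by apply: h; apply/bigfcupP; exists j; rewrite // andbT mem_iota.
- move=> b Bb; apply: (leq_sum_fset (fun b => `|(eta b : int)|%N)); exact: inB.
- move=> j b jn Bb; rewrite /C (bigD1 (Ordinal jn)) //=.
  apply: leq_trans (leq_addr _ _); apply: (leq_sum_fset (@bd_weight _ _ B j)).
  exact: inB.
- move=> j jn; rewrite natrD natrM natrM.
  set k := #|` fset_set (B j)|; set d : R := (#|` D|)%:R.
  have de : 1 <= e * d.
    rewrite mulrC ler_pdivlMr ?mulr_gt0 // mul1r.
    apply: (le_trans (ltW (archi_boundP _))); last by rewrite ler_nat; exact: D_big.
    by rewrite mulr_ge0 // ltW.
  have jk : ((j == 0%N) <= k)%N by rewrite /k; case: j jn {k} => [|j] //=.
  (* The boundary cells number at most e|D|k, and the extra generator costs at most k <= e|D|k; the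
     sum is |D|k/T. *)
  apply: (@le_trans _ _ (e * d * k%:R + e * d * k%:R)).
    apply: lerD; first by rewrite ler_wpM2r.
    apply: (@le_trans _ _ k%:R); first by rewrite ler_nat.
    by rewrite ler_peMl.
  rewrite (_ : _ + _ = T^-1 * (d * k%:R)).
    by rewrite -[kappa * _ * _]mulrA ler_peMl // !mulr_ge0 // invr_ge0 ltW.
  by rewrite /e; field; rewrite gt_eqF.
- by apply: powR_exp_ge => //; apply: le_trans kappa1.
Qed.
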